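(* Let $\kappa$ be a cardinal with $2 \leq \kappa \leq \mathfrak{c}^+$, where $\mathfrak{c} = 2^{\aleph_0}$ and $\mathfrak{c}^+$ is its successor cardinal. Then there exists a branchwise-real tree which is uniformly $\kappa$-branching, rigid, and not continuously gradable.
   Context: Let $X$ be a partial order. A branch of $X$ is a maximal chain (linearly ordered subset). A tree order is a partial order $X$ such that (1) for every $x \in X$ the set $\{y \in X \mid y \leq x\}$ is linearly ordered, and (2) $X$ has a minimum element, its root. A branchwise-real tree is a tree order $X$ such that (a) every branch of $X$ is order-isomorphic to a real interval, and (b) for any $x,y \in X$ the set $\{z \in X \mid z \leq x \text{ and } z \leq y\}$ has a maximum element. For $x$ in a tree order $X$, a component above $x$ is an equivalence class of $\{y \in X \mid y > x\}$ under the relation: $y \sim_x z$ if and only if there is $w > x$ with $w \leq y$ and $w \leq z$. The degree $\deg(x)$ of $x$ is the number (cardinality of the set) of components above $x$. A tree order is uniformly $\kappa$-branching if every point of it has degree $\kappa$. A tree order is rigid if its only order-automorphism (order-preserving bijection to itself with order-preserving inverse) is the identity. A continuous grading of a branchwise-real tree $X$ is a function $\ell \colon X \to \mathbb{R}$ such that $x < y$ implies $\ell(x) < \ell(y)$, and such that for all $x<y$ in $X$ the restriction of $\ell$ to $[x,y] = \{z \in X \mid x \leq z \leq y\}$ is an order-isomorphism onto the real interval $[\ell(x),\ell(y)]$. $X$ is continuously gradable if it admits a continuous grading. *)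

(* Defs.v *)
From HB Require Import structures.
From mathcomp Require Import all_boot all_order all_algebra.
From mathcomp Require Import all_classical all_reals.

Set Implicit Arguments.
Unset Strict Implicit.
Unset Printing Implicit Defensive.

Import Order.TTheory.
Local Open Scope classical_set_scope.
Local Open Scope card_scope.
Local Open Scope order_scope.

(* A cardinal is represented by a type of that
   cardinality. *)

Definition card_lt (A B : Type) : Prop :=
  [set: A] #<= [set: B] /\ ~ ([set: B] #<= [set: A]).

(* [B] has the least cardinality strictly above that of [A]. *)
Definition is_succ_card (A B : Type) : Prop :=
  card_lt A B /\ forall T : Type, card_lt A T -> [set: B] #<= [set: T].

Definition is_min d (X : porderType d) (A : set X) (m : X) : Prop :=
  A m /\ forall x, A x -> m <= x.

Definition is_max d (X : porderType d) (A : set X) (m : X) : Prop :=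
  A m /\ forall x, A x -> x <= m.

(* Only the values of [f] on [A] matter. *)
Definition order_iso_on d d' (X : porderType d) (Y : porderType d')
    (A : set X) (B : set Y) (f : X -> Y) : Prop :=
  set_bij A B f /\ forall x y, A x -> A y -> (f x <= f y) = (x <= y).

Section Trees.
Context (d : Order.disp_t) (X : porderType d).

Definition is_chain (A : set X) : Prop :=
  total_on A (fun x y => x <= y).

Definition is_branch (A : set X) : Prop :=
  is_chain A /\ forall B : set X, is_chain B -> A `<=` B -> B = A.

Definition tree_order : Prop :=
  (forall x : X, is_chain [set y | y <= x]) /\
  (exists r : X, is_min setT r).

(* The terms of [interval R] are the bounded and unbounded, open, closed and
   half-open intervals of [R]. *)
Definition branchwise_real_tree (R : realType) : Prop :=
  [/\ tree_order,
      (forall A : set X, is_branch A ->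
         exists (I : interval R) (f : X -> R), order_iso_on A [set` I] f) &
      (forall x y : X, exists m : X, is_max [set z | z <= x /\ z <= y] m)].

Definition same_component (x y z : X) : Prop :=
  exists w : X, [/\ x < w, w <= y & w <= z].

Definition components (x : X) : set (set X) :=
  [set [set z | x < z /\ same_component x y z] | y in [set y | x < y]].

Definition uniformly_branching (K : Type) : Prop :=
  forall x : X, components x #= [set: K].

Definition rigid : Prop :=
  forall f g : X -> X, cancel f g -> cancel g f ->
    {homo f : x y / x <= y} -> {homo g : x y / x <= y} -> f =1 id.

Definition continuous_grading (R : realType) (l : X -> R) : Prop :=
  {homo l : x y / x < y} /\
  forall x y : X, x < y ->
    order_iso_on [set z | x <= z <= y] [set r : R | l x <= r <= l y] l.

Definition continuously_gradable (R : realType) : Prop :=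
  exists l : X -> R, continuous_grading l.

End Trees.

Arguments tree_order {d} X.
Arguments branchwise_real_tree {d} X R.
Arguments uniformly_branching {d} X K.
Arguments rigid {d} X.
Arguments continuously_gradable {d} X R.

(* Main.v *)
Require Import Defs.
From HB Require Import structures.
From mathcomp Require Import all_boot all_order all_algebra.
From mathcomp Require Import all_classical all_reals.
From mathcomp Require wochoice.
From mathcomp Require Import lra.

(* A point of the tree is a path: a well-ordered sequence of rays, each of which
   is a copy of the half-line and is left at some height for a new one.  Paths
   carry a real clock.  The ray entered at time v with index k (an element of K)
   is coloured by positive reals, and leaving it at height t costs the colour of
   t, so that the clock strictly increases from ray to ray.  A sequence of rays
   that has no last one has a limit point if and only if its clock is bounded.
   The clock shows that every branch is a real interval, by mapping the stay on
   each ray linearly onto the time it costs.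

   Not gradable: given a grading l, one can always continue a path, as in
   Kurepa's theorem, with the clock bounded by a bounded increasing function of
   l, and at limits too; Zorn's lemma gives a contradiction.

   Rigid: the colourings are mutually generic, that is, for two distinct rays and
   an increasing bijection h between two of their segments (or for the same ray,
   if h is not the identity), the colours at t and h(t) can be prescribed
   simultaneously.  If an automorphism changes the ray leading out of some point,
   then one can therefore choose successive rays along which the clock converges
   while it diverges along the image, although only the first sequence has a
   limit point.  Generic colourings are obtained from one generic map on the
   line, which is built by transfinite recursion, and from the K x R many
   functions on continuum many labels that are pairwise independent: this is
   where the injection of K into the power set of the continuum is used. *)

Set Implicit Arguments.
Unset Strict Implicit.
Unset Printing Implicit Defensive.

Import Order.TTheory GRing.Theory Num.Theory.

Local Open Scope classical_set_scope.
Local Open Scope card_scope.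
Local Open Scope ring_scope.

(** * Types of size at most the continuum *)

Definition csurj (T : Type) : Prop :=
  exists s : (nat -> bool) -> T, forall y, exists x, s x = y.

Lemma csurj_prod (T U : Type) : csurj T -> csurj U -> csurj (T * U).
Proof.
move=> [s sP] [r rP].
exists (fun x => (s (fun n => x n.*2), r (fun n => x n.*2.+1))) => -[y z].
have [x xy] := sP y; have [w wz] := rP z.
exists (fun n => if odd n then w n./2 else x n./2); rewrite -xy -wz.
congr pair; congr (_ _); apply/funext => n; rewrite /= odd_double /=.
  by rewrite doubleK.
by rewrite uphalf_double.
Qed.

Lemma csurj_fun (I : countType) (T : Type) : csurj T -> csurj (I -> T).
Proof.
move=> [s sP]; exists (fun x i => s (fun n => x (pickle (i, n)))) => F.
have [c cP] := choice (fun i => sP (F i)).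
exists (fun m => if unpickle m is Some (i, n) then c i n else false).
apply/funext => i; rewrite -cP; congr (s _); apply/funext => n.
by rewrite pickleK.
Qed.

Lemma sup_eq (R : realType) (S : set R) (r : R) :
  (forall y, S y -> y <= r) -> (forall y, y < r -> exists2 z, S z & y < z) ->
  sup S = r.
Proof.
move=> ubS lubS; have [z Sz _] := lubS (r - 1) ltac:(lra).
have hs : has_sup S by split; [exists z | exists r].
apply/eqP; rewrite eq_le; apply/andP; split; first exact: ge_sup (ex_intro _ z Sz) _.
rewrite leNgt; apply/negP => /lubS[y Sy]; rewrite ltNge => /negP; apply.
exact: sup_upper_bound.
Qed.

(** A real is the supremum of the rationals below it, so a sequence of bits codes it as a set of
    rationals. *)
Lemma csurj_real (R : realType) : csurj R.
Proof.
exists (fun x => sup [set r : R | exists q : rat, x (pickle q) /\ r = ratr q]) => r.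
exists (fun m => if unpickle m is Some q then ratr q < r else false).
apply: sup_eq => [y [q]|y yr]; first by rewrite pickleK => -[/ltW qr ->].
have [q /itvP yqr] := rat_in_itvoo yr.
by exists (ratr q); [exists q; rewrite pickleK yqr | rewrite yqr].
Qed.

(** * Cantor space inside every real interval *)

Section TernaryEmbedding.
Context (R : realType).
Implicit Types x y : nat -> bool.

Let psum x n : R := \sum_(i < n) (x i)%:R / 3 ^+ i.+1.

Let psumS x n : psum x n.+1 = psum x n + (x n)%:R / 3 ^+ n.+1.
Proof. by rewrite /psum big_ord_recr. Qed.

(** The digits from [n] on contribute at most a geometric series of sum [3 ^- n / 2]; adding this
    remainder makes the partial sums nonincreasing. *)
Let psum_tail x n m : psum x (n + m) + 3 ^- (n + m) / 2 <= psum x n + 3 ^- n / 2.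
Proof.
elim: m => [|m IH]; first by rewrite addn0.
apply: le_trans IH; rewrite addnS psumS exprS invfM.
have : 0 < (3 : R) ^- (n + m) by rewrite invr_gt0 exprn_gt0.
by case: (x _) => /=; set e := 3 ^- _ => e0; lra.
Qed.

Let psum_mono x n m : psum x n <= psum x (n + m).
Proof.
elim: m => [|m IH]; first by rewrite addn0.
by apply: le_trans IH _; rewrite addnS psumS lerDl divr_ge0 // exprn_ge0.
Qed.

Let psum_bound x n m : psum x m <= psum x n + 3 ^- n / 2.
Proof.
have [/subnKC <-|/ltnW/subnKC nm] := leqP n m.
  apply: le_trans (psum_tail x n (m - n)).
  by rewrite lerDl divr_ge0 // invr_ge0 exprn_ge0.
rewrite -[in leRHS]nm; apply: le_trans (psum_mono x m (n - m)) _.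
by rewrite lerDl divr_ge0 // invr_ge0 exprn_ge0.
Qed.

Let tern x : R := sup (range (psum x)).

Let tern_ge x n : psum x n <= tern x.
Proof.
apply: ub_le_sup; last by exists n.
by exists (psum x 0 + 3 ^- 0 / 2) => _ [m _ <-].
Qed.

Let tern_le x n : tern x <= psum x n + 3 ^- n / 2.
Proof.
by apply: ge_sup; [exists (psum x 0), 0 | move=> _ [m _ <-]; exact: psum_bound].
Qed.

(** At the first difference [x] gains [3 ^- n.+1], while the later digits of [y] make up for at most
    half of it. *)
Let tern_lt x y n : (forall i, (i < n)%N -> x i = y i) -> x n -> ~~ y n ->
  tern y < tern x.
Proof.
move=> xy xn yn; apply: le_lt_trans (tern_le y n.+1) _.
apply: lt_le_trans (tern_ge x n.+1); rewrite !psumS xn (negbTE yn) /=.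
have -> : psum x n = psum y n by apply: eq_bigr => i _; rewrite xy.
have : 0 < (3 : R) ^- n.+1 by rewrite invr_gt0 exprn_gt0.
by set e := 3 ^- _ => e0; lra.
Qed.

Let tern_inj : injective tern.
Proof.
move=> x y xy; apply/funext => n; elim/ltn_ind: n => n IH.
apply/eqP; apply/negPn/negP => xyn.
have [xn|xn] := boolP (x n).
  have yn : ~~ y n by move: xyn; rewrite xn; case: (y n).
  by have := tern_lt IH xn yn; rewrite xy ltxx.
have yn : y n by move: xyn; rewrite (negbTE xn); case: (y n).
by have := tern_lt (fun i iI => esym (IH i iI)) yn xn; rewrite xy ltxx.
Qed.

Lemma cantor_embeds_itv (a b : R) : a < b ->
  exists2 f : (nat -> bool) -> R, injective f & forall x, a < f x < b.
Proof.
(* [tern] has values in [0, 1/2], so that the factor [(1 + tern x) / 4] stays strictly between 0 and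
   1. *)
move=> ab; exists (fun x => a + (b - a) * (1 + tern x) / 4).
  move=> x y /= fxy; apply: tern_inj; apply/eqP; rewrite -subr_eq0.
  have /eqP : (b - a) * (tern x - tern y) = 0 by lra.
  by rewrite mulf_eq0 [b - a == 0]gt_eqF // subr_gt0.
move=> x; have := tern_ge x 0; have := tern_le x 0.
rewrite /psum !big_ord0 expr0 invr1 => h1 h2; apply/andP; split; nra.
Qed.

End TernaryEmbedding.

(** This expresses that [S] has fewer elements than the continuum: no map sends it onto Cantor
    space. *)
Definition csmall (T : Type) (S : set T) : Prop :=
  forall s : T -> nat -> bool, exists b, forall y, S y -> s y <> b.

(* Koenig's diagonal argument. *)
Lemma csmall_not_cover (R : realType) (T : Type) (S : set T) (u : nat -> T -> R)
    (a b : R) : csmall S -> a < b ->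
  exists2 r, a < r < b & forall n y, S y -> u n y <> r.
Proof.
move=> smallS /cantor_embeds_itv[f f_inj f_itv].
pose g r : nat -> bool := xget (fun=> false) [set x | f x = r].
have fK x : g (f x) = x by apply: xget_unique => // y /f_inj.
(* Split into countably many rows, the point [d] gets as row [n] a sequence that no code [g (u n y)]
   has as its row [n]. *)
have [c cP] := choice (fun n => smallS (fun y m => g (u n y) (pickle (n, m)))).
pose d k := if unpickle k is Some (n, m) then c n m else false.
exists (f d) => // n y Sy uny; apply: (cP n y Sy).
by apply/funext => m; rewrite uny fK /d pickleK.
Qed.

(** This plays the role of the initial ordinal of the continuum. In a well-order of [T], [A] is
    everything if all proper initial segments are small, and otherwise the first one that is not;
    the failure of smallness is a map of it onto Cantor space. *)
Lemma exists_csmall_well_order (T : eqType) (s0 : T -> nat -> bool) :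
  (forall b, exists x, s0 x = b) ->
  exists (A : set T) (lt : T -> T -> Prop),
  [/\ well_founded lt, forall x y, [\/ lt x y, x = y | lt y x],
      forall x, A x -> csmall [set y | lt y x] &
      exists s : T -> nat -> bool, forall b, exists2 y, A y & s y = b].
Proof.
move=> s0P; have [le le_wo] := wochoice.well_ordering_principle T.
pose lt x y := ~~ le y x.
have le_refl x : le x x.
  have [|z [[]]] := le_wo (pred1 x); first by exists x; rewrite inE.
  by rewrite inE => /eqP -> /(_ x); rewrite inE => /(_ (eqxx x)).
have lt_wf : well_founded lt.
  move=> x; apply: contrapT => nx.
  have [|z [[zA zmin] _]] := le_wo [pred x | `[< ~ Acc lt x >]].
    by exists x; apply/asboolP.
  move/asboolP: zA; apply; constructor => y; rewrite /lt => /negP yz.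
  by apply: contrapT => ny; apply: yz; apply: zmin; apply/asboolP.
have lt_tri x y : [\/ lt x y, x = y | lt y x].
  have [xy|] := boolP (le x y); last by constructor 3.
  have [yx|] := boolP (le y x); last by constructor 1.
  have [|z [_ zuniq]] := le_wo (pred2 x y); first by exists x; rewrite !inE eqxx.
  constructor 2; transitivity z; [symmetry|]; apply: zuniq;
    by split=> [|w]; rewrite !inE ?eqxx ?orbT // => /orP[] /eqP ->.
have [allsmall|] := pselect (forall x, csmall [set y | lt y x]).
  exists setT, lt; split => //; exists s0 => b.
  by have [x <-] := s0P b; exists x.
move=> /existsNP[x0]; elim/(well_founded_ind lt_wf): x0 => x0 IH nsmall.
have [/existsNP[x]|] := pselect (~ forall x, lt x x0 -> csmall [set y | lt y x]).
  by move=> /not_implyP[xx0]; exact: IH.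
move=> /contrapT xsmall; exists [set x | lt x x0], lt; split=> //.
move/existsNP: nsmall => [s /forallNP sP]; exists s => b.
have /existsNP[y /not_implyP[yx /contrapT <-]] := sP b.
by exists y.
Qed.

(** * Generic colourings of the line *)

Definition increasing_on (R : realType) (a b : R) (h : R -> R) : Prop :=
  forall s t, a < s -> s < t -> t < b -> h s < h t.

Definition convex_image_on (R : realType) (a b : R) (h : R -> R) : Prop :=
  forall s t y, a < s -> s < t -> t < b -> h s < y < h t ->
    exists2 u, s < u < t & h u = y.

Lemma increasing_on_inj (R : realType) (a b : R) (h : R -> R) (s t : R) :
  increasing_on a b h -> a < s < b -> a < t < b -> h s = h t -> s = t.
Proof.
move=> hinc /andP[as_ sb] /andP[at_ tb] st; case: (ltgtP s t) => // lt_st.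
  by have := hinc _ _ as_ lt_st tb; rewrite st ltxx.
by have := hinc _ _ at_ lt_st sb; rewrite st ltxx.
Qed.

Section Generic.
Context (R : realType) (Z : choiceType) (z0 : Z).
Hypothesis csurjZ : csurj Z.

(* The increasing functions with convex image on ]a, b[ are determined by their
   values at the rationals, so that there are only continuum many of them. *)
Let rat_ext (a : R) (e : rat -> R) (t : R) : R :=
  sup [set y | exists q, [/\ a < ratr q, ratr q < t & y = e q]].

Let rat_extE a b h : increasing_on a b h -> convex_image_on a b h ->
  forall t, a < t < b -> rat_ext a (fun q => h (ratr q)) t = h t.
Proof.
move=> hinc hconv t /andP[ta tb].
apply: sup_eq => [_ [q [aq qt ->]]|y yt]; first exact/ltW/hinc.
have [s0 [as0 s0t]] : exists s0, a < s0 /\ s0 < t.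
  by exists ((a + t) / 2); split; lra.
have [s [as_ st ys]] : exists s, [/\ a < s, s < t & y <= h s].
  have [ys0|ys0] := leP y (h s0); first by exists s0.
  have [|u /andP[su ut] <-] := hconv _ _ y as0 s0t tb; first by rewrite ys0.
  by exists u; split => //; apply: lt_trans su.
have [q /itvP stq] := rat_in_itvoo st.
have aq : a < ratr q :> R by apply: (lt_trans as_); rewrite stq.
exists (h (ratr q)); first by exists q; split => //; rewrite stq.
by apply: le_lt_trans ys _; apply: hinc; rewrite ?stq //; apply: lt_trans tb; rewrite stq.
Qed.

(** Each stage of a transfinite recursion decodes to an interval, a map given at the rationals, and
    two labels. It picks a point of the interval such that neither the point nor its image was used
    before, and labels the two. The stages before it form a small set, so they leave such a point;
    it is not fixed by the map, so the two labels do not collide. *)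
Lemma exists_generic : exists G : R -> Z, forall a b h z w,
  a < b -> increasing_on a b h -> convex_image_on a b h ->
  (forall t, a < t < b -> h t <> t) ->
  exists2 t, a < t < b & G t = z /\ G (h t) = w.
Proof.
pose T : eqType := nat -> bool.
have [A [lt [lt_wf lt_tri smallA [s sP]]]] :=
  @exists_csmall_well_order T id (fun b => ex_intro _ b erefl).
have [dec decP] : csurj ((R * R) * (rat -> R) * (Z * Z)).
  have cR := csurj_real R.
  by do !apply: csurj_prod => //; apply: csurj_fun.
pose lo rho := (dec (s rho)).1.1.1; pose hi rho := (dec (s rho)).1.1.2.
pose fn rho := rat_ext (lo rho) (dec (s rho)).1.2.
pose zz rho := (dec (s rho)).2.1; pose ww rho := (dec (s rho)).2.2.
pose suit rho (U : set R) := [set t |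
  [/\ lo rho < t < hi rho, fn rho t <> t, ~ U t & ~ U (fn rho t)]].
pose step rho (F : forall sig, lt sig rho -> R) := xget 0 (suit rho
  [set r | exists sig (p : lt sig rho), r = F sig p \/ r = fn sig (F sig p)]).
pose tt := Fix lt_wf (fun=> R) step.
pose U rho := [set r | exists sig, lt sig rho /\ (r = tt sig \/ r = fn sig (tt sig))].
have ttE rho : tt rho = xget 0 (suit rho (U rho)).
  rewrite /tt Fix_eq; last first.
    move=> x f g fg; congr (step x _).
    by apply/functional_extensionality_dep => y; apply/funext.
  congr (xget 0 (suit rho _)); apply/seteqP; split=> r.
    by move=> [sig [p h]]; exists sig.
  by move=> [sig [p h]]; exists sig, p.
(* Without a suitable point [tt rho] is the default [0]; only good stages label points. *)
pose good rho := A rho /\ suit rho (U rho) (tt rho).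
pose P t z := exists rho, good rho /\
  ((t = tt rho /\ z = zz rho) \/ (t = fn rho (tt rho) /\ z = ww rho)).
have P_uniq t z z' : P t z -> P t z' -> z = z'.
  move=> [rho [[Arho [_ fixrho Ut Uft] tz]]] [sig [[Asig [_ fixsig Ut' Uft'] tz']]].
  have [rhosig|eq_rs|sigrho] := lt_tri rho sig.
  - have Usig : U sig t by exists rho; split=> //; case: tz => -[]; [left|right].
    by case: tz' => -[tE _]; rewrite tE in Usig.
  - case: tz tz' => [] [tE ->] [] [tE' ->]; rewrite ?eq_rs //.
      by case: fixsig; rewrite -tE' tE eq_rs.
    by case: fixrho; rewrite -tE tE' eq_rs.
  - have Urho : U rho t by exists sig; split=> //; case: tz' => -[]; [left|right].
    by case: tz => -[tE _]; rewrite tE in Urho.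
exists (fun t => xget z0 [set z | P t z]) => a b h z w ab hinc hconv hfix.
have GE t y : P t y -> xget z0 [set z | P t z] = y.
  by move=> Pty; apply: xget_unique => // y' /P_uniq/(_ Pty).
have [b0 decE] := decP (a, b, fun q => h (ratr q), (z, w)).
have [rho Arho rhoE] := sP b0.
have fnE t : a < t < b -> fn rho t = h t.
  by move=> tab; rewrite /fn /lo rhoE decE /= (rat_extE hinc hconv).
have [abE zwE] : (lo rho = a /\ hi rho = b) /\ (zz rho = z /\ ww rho = w).
  by rewrite /lo /hi /zz /ww rhoE decE.
pose hinv r := xget 0 [set t | a < t < b /\ h t = r].
have hinvK t : a < t < b -> hinv (h t) = t.
  by move=> tab; apply: xget_unique => // t' [t'ab]; exact: increasing_on_inj hinc _ _.
(* Avoiding the first two maps makes the new point fresh, and avoiding the other two makes its image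
   under [h] fresh. *)
pose u n sig := match n with 0 => tt sig | 1 => fn sig (tt sig)
  | 2 => hinv (tt sig) | _ => hinv (fn sig (tt sig)) end.
have [r rab ruN] := csmall_not_cover u (smallA _ Arho) ab.
have grho : good rho.
  split=> //; rewrite ttE; apply: (xgetI _ (x := r)).
  rewrite /suit /= abE.1 abE.2 fnE //; split => //; first exact: hfix.
    by move=> [sig [ltsig [rE|rE]]]; [apply: (ruN 0 sig)|apply: (ruN 1 sig)].
  move=> [sig [ltsig [rE|rE]]]; [apply: (ruN 2 sig)|apply: (ruN 3 sig)] => //=;
    by rewrite -rE hinvK.
have [_ [ttab _ _ _]] := grho; rewrite abE.1 abE.2 in ttab.
exists (tt rho) => //; split; apply: GE; exists rho; split => //.
  by left; rewrite zwE.1.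
by right; rewrite zwE.2 fnE.
Qed.

End Generic.

(** * Mutually generic colourings of the rays *)

Section Colouring.
Context (R : realType) (K : Type) (j : K -> set (nat -> bool)).
Hypothesis j_inj : injective j.

(** The generic label at [t] is a question about the ray [(v, k)] together with the colours for its
    two answers. Where [h] moves points, two labels are prescribed, each with the same colour for
    both answers; where [h] is the identity, one label whose question separates the two rays gives
    both colours. *)
Lemma exists_colouring : exists col : R -> K -> R -> R,
  (forall v k t, 0 < col v k t) /\
  forall v k v' k' a b h al be, a < b ->
    increasing_on a b h -> convex_image_on a b h ->
    (v, k) <> (v', k') \/ (exists2 t, a < t < b & h t <> t) -> 0 < al -> 0 < be ->
    exists2 t, a < t < b & col v k t = al /\ col v' k' (h t) = be.
Proof.
pose Z : choiceType := ((bool * ((nat -> bool) * R)) * (R * R))%type.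
have csurjZ : csurj Z.
  have cR := csurj_real R; do !apply: csurj_prod => //; last by exists id => y; exists y.
  by exists (fun x => x 0%N) => y; exists (fun=> y).
have [G GP] := @exists_generic R Z (true, (fun=> false, 0), (0, 0)) csurjZ.
(* A question asks whether a given sequence lies in [j k], or whether [v] is below a given real. *)
pose e v k (y : bool * ((nat -> bool) * R)) : bool :=
  if y.1 then `[< j k y.2.1 >] else v < y.2.2.
have e_sep v k v' k' : (v, k) <> (v', k') -> exists y, e v k y != e v' k' y.
  move=> vk; have [vv'|vv'|vv'] := ltgtP v v'.
  - by exists (false, (fun=> false, v')); rewrite /e /= vv' ltxx.
  - by exists (false, (fun=> false, v)); rewrite /e /= vv' ltxx.
  apply: contrapT => /forallNP eN; apply: vk; rewrite vv'; congr pair.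
  apply: j_inj; apply/funext => x; have /negP := eN (true, (x, 0)).
  by rewrite /e /= negbK => /eqP jE; rewrite -[LHS]asboolE -[RHS]asboolE jE.
pose F v k (z : Z) : R := if e v k z.1 then z.2.1 else z.2.2.
exists (fun v k t => let c := F v k (G t) in if 0 < c then c else 1).
split=> [v k t /=|v k v' k' a b h al be ab hinc hconv]; first by case: ifP.
have [hid|] := pselect (forall t, a < t < b -> h t = t); last first.
  move=> /existsNP[t /not_implyP[tab htt]] _ al0 be0.
  (* Since [h] is increasing, it has no fixed point between [t] and [h t]. *)
  have [c [d [ac cd db hcd]]] : exists c d, [/\ a <= c, c < d, d <= b &
      forall t, c < t < d -> h t <> t].
    case/andP: (tab) => at_ tb; case: (ltgtP (h t) t) => // ht.
      exists (Num.max (h t) a), t; rewrite le_max lexx orbT gt_max ht at_ ltW //.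
      split=> // u /andP[]; rewrite gt_max => /andP[hu au] ut hE.
      by have := hinc _ _ au ut tb; rewrite hE => /(lt_trans hu); rewrite ltxx.
    exists t, (Num.min (h t) b); rewrite ge_min lexx orbT lt_min ht tb ltW //.
    split=> // u /andP[tu]; rewrite lt_min => /andP[uh ub] hE.
    by have := hinc _ _ at_ tu ub; rewrite hE => /(lt_trans uh); rewrite ltxx.
  have [//|s u s1 s2 s3|s u y s1 s2 s3|//|u /andP[cu ud] [Gu Ghu]] :=
      GP c d h (true, (fun=> false, 0), (al, al)) (true, (fun=> false, 0), (be, be)).
  - by apply: hinc => //; [exact: le_lt_trans s1|exact: lt_le_trans db].
  - by apply: hconv => //; [exact: le_lt_trans s1|exact: lt_le_trans db].
  exists u; first by rewrite (le_lt_trans ac) // (lt_le_trans ud).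
  by rewrite Gu Ghu /F /= !if_same al0 be0.
move=> [vk|[t tab]]; last by rewrite hid.
move=> al0 be0; have [y ey] := e_sep _ _ _ _ vk.
pose p := if e v k y then (al, be) else (be, al).
(* Only the label at [t] is wanted here; the translation serves as a map without fixed points. *)
have [|||t /andP[at_ tb] [Gt _]] := GP a b (fun t => t + 1) (y, p) (y, p) ab.
- by move=> s t _ st _; rewrite ltrD2r.
- move=> s t z _ _ _ /andP[h1 h2]; exists (z - 1); rewrite ?subrK //.
  by rewrite ltrBrDr ltrBlDr h1.
- by move=> t _ h1; lra.
exists t; rewrite ?at_ // hid ?at_ // Gt /F /p /=.
by case: (e v k y) (e v' k' y) ey => -[] //=; rewrite al0 be0.
Qed.

End Colouring.

(** * The tree *)

Section Tree.
Context (R : realType) (K : Type) (k0 : K) (col : R -> K -> R -> R).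

Definition nxt (p : R -> K * R) (v : R) : R := v + col v (p v).1 (p v).2.

(* [p v = (k, t)] with [0 <= t] means that at time [v] the path enters a new
   ray, of index [(v, k)], and leaves it at height [t], which it does at time
   [nxt p v], or ends there if [v = s].  The value at the other times is
   [(k0, -1)].  A ray that is entered at a limit time starts with a point of
   its own, of height [0], which is represented with the index [k0]. *)
Record valid (p : R -> K * R) (s : R) : Prop := Valid {
  valid_end : 0 <= (p s).2;
  valid_end0 : (p s).2 = 0 -> (p s).1 = k0;
  valid_on : forall v, 0 <= (p v).2 -> 0 <= v <= s;
  valid_off : forall v, (p v).2 < 0 -> p v = (k0, -1);
  valid_nxt : forall v, v < s -> 0 <= (p v).2 -> 0 < (p v).2 /\ nxt p v <= s;
  valid_gap : forall v u, v < s -> 0 <= (p v).2 -> v < u < nxt p v -> (p u).2 < 0;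
  valid_new : forall v, v < s -> 0 <= (p v).2 -> (p (nxt p v)).1 <> k0;
  valid_cover : forall u, 0 <= u < s -> exists v, 0 <= (p v).2 /\ v <= u < nxt p v }.

Record point := Point {
  hist :> R -> K * R;
  clock : R;
  pointP : valid hist clock }.

HB.instance Definition _ := gen_eqMixin point.
HB.instance Definition _ := gen_choiceMixin point.

Implicit Types x y z : point.

Definition pos x : R := (x (clock x)).2.

(** Indices are not compared at height [0], because that point lies below all the rays entered at
    the same limit time. *)
Definition le_point x y : Prop :=
  [/\ forall v, v < clock x -> x v = y v,
      pos x <= (y (clock x)).2 &
      pos x = 0 \/ (x (clock x)).1 = (y (clock x)).1].

Lemma clock_ge0 x : 0 <= clock x.
Proof. by have /andP[] := valid_on (pointP x) (valid_end (pointP x)). Qed.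

Lemma pos_ge0 x : 0 <= pos x.
Proof. exact: valid_end (pointP x). Qed.

Lemma on_ge0 x v : 0 <= (x v).2 -> 0 <= v.
Proof. by move=> /(valid_on (pointP x))/andP[]. Qed.

Lemma on_le x v : 0 <= (x v).2 -> v <= clock x.
Proof. by move=> /(valid_on (pointP x))/andP[]. Qed.

Lemma off_eq x y v : (x v).2 < 0 -> (y v).2 < 0 -> x v = y v.
Proof. by move=> /(valid_off (pointP x)) -> /(valid_off (pointP y)) ->. Qed.

Lemma off_neg x v : v < 0 -> (x v).2 < 0.
Proof. by move=> v0; rewrite ltNge; apply/negP => /on_ge0; rewrite leNgt v0. Qed.

Lemma off_gt x v : clock x < v -> (x v).2 < 0.
Proof. by move=> v0; rewrite ltNge; apply/negP => /on_le; rewrite leNgt v0. Qed.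

Lemma le_point_refl x : le_point x x.
Proof. by split => //; right. Qed.

Lemma le_point_on x y : le_point x y -> 0 <= (y (clock x)).2.
Proof. by case=> _ + _; apply: le_trans; exact: pos_ge0. Qed.

Lemma le_point_clock x y : le_point x y -> clock x <= clock y.
Proof. by move=> /le_point_on/on_le. Qed.

Lemma point_eq x y : (forall v, x v = y v) -> clock x = clock y -> x = y.
Proof.
case: x y => [p s ps] [q r qr] /= /funext pq sr.
by move: ps; rewrite pq sr => ps; congr Point; exact: Prop_irrelevance.
Qed.

Lemma le_point_anti x y : le_point x y -> le_point y x -> x = y.
Proof.
move=> xy yx; have sxy : clock x = clock y.
  by apply/eqP; rewrite eq_le !le_point_clock.
apply: point_eq => // v; case: (ltgtP v (clock x)) => [vx|vx|->].
- by case: xy => /(_ _ vx).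
- by apply: off_eq; apply: off_gt; rewrite -?sxy.
case: xy yx => [_ pxy kxy] [_ pyx _]; rewrite -sxy in pyx.
have pE : pos x = (y (clock x)).2.
  by apply/eqP; rewrite eq_le pxy; move: pyx; rewrite /pos -sxy.
rewrite [LHS]surjective_pairing [RHS]surjective_pairing -pE; congr pair.
case: kxy => // px0; rewrite (valid_end0 (pointP x)) //.
by rewrite sxy (valid_end0 (pointP y)) // -sxy -pE.
Qed.

Lemma le_point_trans y x z : le_point x y -> le_point y z -> le_point x z.
Proof.
move=> xy yz; have sxy := le_point_clock xy.
case: xy yz => [axy pxy kxy] [ayz pyz kyz].
have axz v : v < clock x -> x v = z v.
  by move=> vx; rewrite axy // ayz //; apply: lt_le_trans vx sxy.
move: sxy; rewrite le_eqVlt => /orP[/eqP sxy|sxy].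
  rewrite -sxy in kyz pyz; split=> //.
    by apply: le_trans pyz; rewrite /pos -sxy.
  case: kxy => [|kxy]; first by left.
  case: kyz => [py0|kyz]; last by right; rewrite kxy.
  left; apply/eqP; rewrite eq_le pos_ge0 andbT -[0]py0.
  by apply: le_trans pxy _; rewrite /pos -sxy.
by split=> //; rewrite -ayz.
Qed.

Definition le_pointb x y : bool := `[< le_point x y >].

Fact le_pointb_refl : reflexive le_pointb.
Proof. by move=> x; apply/asboolP/le_point_refl. Qed.

Fact le_pointb_anti : antisymmetric le_pointb.
Proof. by move=> x y /andP[/asboolP xy /asboolP]; exact: le_point_anti. Qed.

Fact le_pointb_trans : transitive le_pointb.
Proof. by move=> y x z /asboolP xy /asboolP yz; apply/asboolP/(le_point_trans xy). Qed.

HB.instance Definition _ := Order.Le_isPOrder.Build ring_display point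
  le_pointb_refl le_pointb_anti le_pointb_trans.

Lemma lepP x y : reflect (le_point x y) (x <= y).
Proof. exact: asboolP. Qed.

Lemma le_clock x y : x <= y -> clock x <= clock y.
Proof. by move=> /lepP/le_point_clock. Qed.

Lemma le_on x y : x <= y -> 0 <= (y (clock x)).2.
Proof. by move=> /lepP/le_point_on. Qed.

Lemma le_agree x y v : x <= y -> v < clock x -> x v = y v.
Proof. by move=> /lepP[+ _ _]; exact. Qed.

Lemma le_pos x y : x <= y -> pos x <= (y (clock x)).2.
Proof. by move=> /lepP[]. Qed.

Lemma le_index x y : x <= y -> 0 < pos x -> (x (clock x)).1 = (y (clock x)).1.
Proof. by move=> /lepP[_ _ []] // ->; rewrite ltxx. Qed.

Lemma le_total_below x y z : x <= z -> y <= z -> x <= y \/ y <= x.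
Proof.
(* Points below a common one are ordered lexicographically by clock and height. *)
wlog: x y / (clock x < clock y) || (clock x == clock y) && (pos x <= pos y).
  move=> H xz yz; case: (ltgtP (clock x) (clock y)) => sxy.
  - by apply: H => //; rewrite sxy.
  - by apply/or_comm; apply: H => //; rewrite sxy.
  - case: (leP (pos x) (pos y)) => [pxy|/ltW pxy].
      by apply: H => //; rewrite sxy eqxx pxy orbT.
    by apply/or_comm; apply: H => //; rewrite sxy eqxx pxy orbT.
move=> sxy xz yz; left; apply/lepP; split.
- move=> v vx; rewrite (le_agree xz) // (le_agree yz) //.
  apply: lt_le_trans vx _.
  by case/orP: sxy => [/ltW //|/andP[/eqP -> _]].
- case/orP: sxy => [sxy|/andP[/eqP sxy pxy]]; last by rewrite sxy.
  by rewrite (le_agree yz sxy); exact: le_pos.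
- have := pos_ge0 x; rewrite le_eqVlt => /orP[/eqP <-|px]; [by left|right].
  rewrite (le_index xz px).
  case/orP: sxy => [sxy|/andP[/eqP sxy pxy]]; first by rewrite (le_agree yz sxy).
  by rewrite sxy (le_index yz) //; apply: lt_le_trans px pxy.
Qed.

Hypothesis col_gt0 : forall v k t, 0 < col v k t.

Lemma nxt_gt (p : R -> K * R) v : v < nxt p v.
Proof. by rewrite ltrDl. Qed.

Lemma nxt_le_on x u v : 0 <= (x u).2 -> 0 <= (x v).2 -> u < v -> nxt x u <= v.
Proof.
move=> xu xv uv; rewrite leNgt; apply/negP => vn.
have := valid_gap (pointP x) (lt_le_trans uv (on_le xv)) xu.
by move=> /(_ v); rewrite uv vn ltNge xv => /(_ isT).
Qed.

Lemma on_nxt x v : v < clock x -> 0 <= (x v).2 -> 0 <= (x (nxt x v)).2.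
Proof.
move=> vs xv; have [_] := valid_nxt (pointP x) vs xv.
rewrite le_eqVlt => /orP[/eqP ->|ns]; first exact: pos_ge0.
have [|w [xw /andP[wn nw]]] := valid_cover (pointP x) (u := nxt x v).
  by rewrite ns andbT ltW // (le_lt_trans (on_ge0 xv)) // nxt_gt.
case: (ltgtP w v) => [wv|vw|wv].
- by have := lt_le_trans nw (nxt_le_on xw xv wv); rewrite ltNge (ltW (nxt_gt _ _)).
- by have /eqP <- : w == nxt x v by rewrite eq_le wn nxt_le_on.
- by move: nw; rewrite wv ltxx.
Qed.

Lemma on0 x : 0 <= (x 0).2.
Proof.
have := clock_ge0 x; rewrite le_eqVlt => /orP[/eqP s0|s0].
  by rewrite [X in x X]s0; exact: pos_ge0.
have [|v [xv /andP[v0 _]]] := valid_cover (pointP x) (u := 0); first by rewrite lexx.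
have /eqP vE : v == 0 by rewrite eq_le v0 (on_ge0 xv).
by rewrite vE in xv.
Qed.

Lemma agree_nxt x y v : v < clock x -> v < clock y -> 0 <= (x v).2 ->
  (forall u, u <= v -> x u = y u) -> forall u, u < nxt x v -> x u = y u.
Proof.
move=> vx vy xv axy u un; have [|vu] := leP u v; first exact: axy.
have nE : nxt x v = nxt y v by rewrite /nxt axy.
apply: off_eq.
  by apply: (valid_gap (pointP x) vx xv); rewrite vu.
by apply: (valid_gap (pointP y) vy); rewrite -?axy // vu -nE.
Qed.

(** The time [w] is the supremum of the times before which the paths agree. Both enter a ray at [w]:
    a ray entered earlier and still in use would carry the agreement on to the time it is left. *)
Lemma first_difference x y : exists w, [/\ 0 <= (x w).2, 0 <= (y w).2,
  forall v, v < w -> x v = y v & x w <> y w \/ (w = clock x \/ w = clock y)].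
Proof.
pose A := [set w | [/\ 0 <= w, w <= clock x, w <= clock y &
  forall v, v < w -> x v = y v]].
have A0 : A 0.
  split; rewrite ?clock_ge0 // => v v0.
  by apply: off_eq; exact: off_neg.
have hsA : has_sup A by split; [exists 0 | exists (clock x) => w []].
pose w := sup A.
have Aw : A w.
  split; first exact: sup_upper_bound.
  - by apply: ge_sup; [exists 0 | move=> ? []].
  - by apply: ge_sup; [exists 0 | move=> ? []].
  - move=> v /sup_gt[|u [_ _ _ au] vu]; [by exists 0 | exact: au].
have [w0 wx wy aw] := Aw.
have nA v : v <= w -> v < clock x -> v < clock y -> 0 <= (x v).2 -> x v = y v ->
    nxt x v <= w.
  move=> vw vx vy xv xyv; apply: sup_upper_bound => //.
  have yv : 0 <= (y v).2 by rewrite -xyv.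
  have [_ nx] := valid_nxt (pointP x) vx xv.
  have [_ ny] := valid_nxt (pointP y) vy yv.
  have nE : nxt x v = nxt y v by rewrite /nxt xyv.
  split; rewrite ?nE // -?nE //.
    by rewrite ltW // (le_lt_trans (on_ge0 xv)) ?nxt_gt.
  apply: agree_nxt => // u; rewrite le_eqVlt => /orP[/eqP -> //|uv].
  by apply: aw; apply: lt_le_trans vw.
have xw : 0 <= (x w).2.
  move: wx; rewrite le_eqVlt => /orP[/eqP ->|wx]; first exact: pos_ge0.
  have [|v [xv /andP[]]] := valid_cover (pointP x) (u := w); first by rewrite w0.
  rewrite le_eqVlt => /orP[/eqP <- //|vw wn].
  have := nA v (ltW vw) (lt_trans vw wx) (lt_le_trans vw wy) xv (aw _ vw).
  by rewrite leNgt wn.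
have yw : 0 <= (y w).2.
  move: wy; rewrite le_eqVlt => /orP[/eqP ->|wy]; first exact: pos_ge0.
  have [|v [yv /andP[]]] := valid_cover (pointP y) (u := w); first by rewrite w0.
  rewrite le_eqVlt => /orP[/eqP <- //|vw wn].
  have xv : 0 <= (x v).2 by rewrite aw.
  have := nA v (ltW vw) (lt_le_trans vw wx) (lt_trans vw wy) xv (aw _ vw).
  by rewrite /nxt (aw v) // leNgt wn.
exists w; split=> //; apply: contrapT.
move=> /not_orP[/contrapT xyw /not_orP[/eqP nx /eqP ny]].
have := nA w (lexx _); rewrite !lt_neqAle nx ny wx wy => /(_ isT isT xw xyw).
by rewrite leNgt nxt_gt.
Qed.

(** * Extending and cutting paths *)

Definition exth x w (k : K) (u : R) (v : R) : K * R :=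
  if v < w then x v else if v == w then (k, u) else (k0, -1).

(** The last ray of the new path either replaces one that [x] enters at [w], or follows the last ray
    of [x], which can be left only at positive height. *)
Definition extendable x w := 0 <= (x w).2 \/ w = nxt x (clock x) /\ 0 < pos x.

(** Time [0] counts as a limit time, since no ray is entered before it. *)
Definition limit_time x w := forall v, v < w -> 0 <= (x v).2 -> nxt x v <> w.

Lemma exth_valid x w k u : extendable x w -> 0 <= u -> (u = 0 -> k = k0) ->
  (limit_time x w \/ k <> k0) -> valid (exth x w k u) w.
Proof.
move=> xw u0 uk lk; set p := exth x w k u.
have pw : p w = (k, u) by rewrite /p /exth ltxx eqxx.
have pv v : v < w -> p v = x v by rewrite /p /exth => ->.
have pgt v : w < v -> p v = (k0, -1) by move=> wv; rewrite /p /exth ltNge ltW //= gt_eqF.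
have nv v : v < w -> nxt p v = nxt x v by move=> vw; rewrite /nxt pv.
have xw0 : 0 <= w.
  by case: xw => [/on_ge0 //|[-> _]]; rewrite ltW // (le_lt_trans (clock_ge0 x)) ?nxt_gt.
have xv v : v < w -> 0 <= (x v).2 -> [/\ 0 < (x v).2, nxt x v <= w &
    forall r, v < r < nxt x v -> (x r).2 < 0].
  move=> vw xv; case: xw => [xw|[wE px]].
    have vs := lt_le_trans vw (on_le xw); split=> [||r];
      last exact: (valid_gap (pointP x) vs xv).
      by have [] := valid_nxt (pointP x) vs xv.
    exact: nxt_le_on.
  have := on_le xv; rewrite le_eqVlt => /orP[/eqP vE|vs].
    rewrite vE wE; split=> // r /andP[sr _]; exact: off_gt.
  have [pv0 nvs] := valid_nxt (pointP x) vs xv; split=> // [|r].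
    by rewrite wE (le_trans nvs) // ltW // nxt_gt.
  exact: (valid_gap (pointP x) vs xv).
split; rewrite ?pw //.
- move=> v; case: (ltgtP v w) => [vw|wv|->]; last by rewrite xw0.
    by rewrite pv // => /on_ge0 ->.
  by rewrite pgt //= => ?; lra.
- move=> v; case: (ltgtP v w) => [vw|wv|->]; last by rewrite pw ltNge u0.
    by rewrite pv // => /(valid_off (pointP x)).
  by rewrite pgt.
- by move=> v vw; rewrite nv // pv // => /(xv _ vw)[].
- move=> v r vw; rewrite nv // pv // => /(xv _ vw)[_ nw gap] rn.
  by rewrite pv ?gap //; case/andP: rn => _ /lt_le_trans; exact.
- move=> v vw; rewrite nv // pv // => xv0; have [xvp nw gap] := xv _ vw xv0.
  move: nw; rewrite le_eqVlt => /orP[/eqP nw|nw].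
    by rewrite nw pw /=; case: lk => // /(_ v vw xv0).
  rewrite pv //; apply: (valid_new (pointP x)) => //.
  rewrite lt_neqAle on_le // andbT; apply/eqP => vE.
  case: xw => [/on_le/(lt_le_trans nw)|[wE _]]; first by rewrite vE ltNge ltW ?nxt_gt.
  by move: nw; rewrite wE vE ltxx.
- move=> r /andP[r0 rw]; case: (ltP r (clock x)) => rs.
    have [|v [xv0 /andP[vr rn]]] := valid_cover (pointP x) (u := r); first by rewrite r0.
    have vw := le_lt_trans vr rw.
    by exists v; rewrite nv // pv // vr.
  case: xw => [/on_le/(lt_le_trans rw)|[wE px]]; first by rewrite ltNge rs.
  have sw : clock x < w by rewrite wE nxt_gt.
  by exists (clock x); rewrite pv // nv // -wE rs rw; split=> //; exact: ltW.
Qed.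

Lemma root_valid : valid (fun v => if v == 0 then (k0, 0) else (k0, -1)) 0.
Proof.
split; rewrite ?eqxx //=.
- by move=> v; case: eqP => [->|_ /=]; rewrite ?lexx //; lra.
- by move=> v; case: eqP => //=; rewrite ltxx.
- by move=> v v0; rewrite lt_eqF //= ler0N1.
- by move=> v u v0; rewrite lt_eqF //= ler0N1.
- by move=> v v0; rewrite lt_eqF //= ler0N1.
- by move=> u /andP[u0]; rewrite ltNge u0.
Qed.

Definition root : point := Point root_valid.

Lemma root_le x : root <= x.
Proof.
apply/lepP; split; rewrite /pos /= ?eqxx /= ?on0 //; last by left.
by move=> v v0; apply: (off_eq (x := root)); exact: off_neg.
Qed.

Definition ext x w k u : point :=
  if pselect (valid (exth x w k u) w) is left h then Point h else root.

Section Ext.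
Variables (x : point) (w : R) (k : K) (u : R).
Hypotheses (xw : extendable x w) (u0 : 0 <= u) (uk : u = 0 -> k = k0).
Hypothesis (lk : limit_time x w \/ k <> k0).

Lemma extE : clock (ext x w k u) = w /\ hist (ext x w k u) = exth x w k u.
Proof. by rewrite /ext; case: pselect => // -[]; exact: exth_valid. Qed.

Lemma clock_ext : clock (ext x w k u) = w. Proof. exact: extE.1. Qed.

Lemma ext_lt v : v < w -> ext x w k u v = x v.
Proof. by rewrite extE.2 /exth => ->. Qed.

Lemma ext_at : ext x w k u w = (k, u).
Proof. by rewrite extE.2 /exth ltxx eqxx. Qed.

Lemma pos_ext : pos (ext x w k u) = u.
Proof. by rewrite /pos clock_ext ext_at. Qed.

End Ext.

(** A ray entered on leaving another one has no point of height [0]: as an end it would have index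
    [k0], against [valid_new], and a ray that is left is left at positive height. *)
Lemma limit_or_nxt x w : 0 <= (x w).2 ->
  limit_time x w \/ exists v, [/\ v < w, 0 <= (x v).2, nxt x v = w,
    (x w).1 <> k0 & 0 < (x w).2].
Proof.
move=> xw; have [|nlim] := pselect (limit_time x w); [by left|right].
move: nlim => /existsNP[v /not_implyP[vw /not_implyP[xv /contrapT vE]]].
have vs := lt_le_trans vw (on_le xw).
have kw := valid_new (pointP x) vs xv; rewrite vE in kw.
exists v; split => //; rewrite lt_neqAle xw andbT eq_sym; apply/eqP => xw0.
have := on_le xw; rewrite le_eqVlt => /orP[/eqP wE|ws].
  by move: xw0 kw; rewrite wE => /(valid_end0 (pointP x)).
by have [+ _] := valid_nxt (pointP x) ws xw; rewrite xw0 ltxx.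
Qed.

Lemma pos0_limit x : pos x = 0 -> limit_time x (clock x).
Proof.
move=> px; have [//|[v [_ _ _ _]]] := limit_or_nxt (pos_ge0 x).
by rewrite -/(pos x) px ltxx.
Qed.

Lemma le_limit x y w : x <= y -> w <= clock x -> limit_time x w -> limit_time y w.
Proof.
move=> xy wx lx v vw; rewrite /nxt -(le_agree xy) ?(lt_le_trans vw) //; exact: lx.
Qed.

(** These are the points below [x]; the index is reset at height [0], as [valid_end0] requires. *)
Definition cut x w u := ext x w (if u == 0 then k0 else (x w).1) u.

Section Cut.
Variables (x : point) (w u : R).
Hypotheses (xw : 0 <= (x w).2) (u0 : 0 <= u) (ul : u = 0 -> limit_time x w).

Let k := if u == 0 then k0 else (x w).1.

Let kP : limit_time x w \/ k <> k0.
Proof.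
have [|[v [_ _ _ kw _]]] := limit_or_nxt xw; first by left.
by rewrite /k; case: eqP => [/ul|_]; [left|right].
Qed.

Let uk : u = 0 -> k = k0. Proof. by rewrite /k => ->; rewrite eqxx. Qed.

Lemma clock_cut : clock (cut x w u) = w.
Proof. by apply: clock_ext => //; left. Qed.

Lemma cut_lt v : v < w -> cut x w u v = x v.
Proof. by move=> vw; apply: ext_lt => //; left. Qed.

Lemma cut_at : cut x w u w = (k, u).
Proof. by apply: ext_at => //; left. Qed.

Lemma pos_cut : pos (cut x w u) = u.
Proof. by apply: pos_ext => //; left. Qed.

Lemma cut_le : u <= (x w).2 -> cut x w u <= x.
Proof.
move=> uw; apply/lepP; rewrite /le_point clock_cut pos_cut cut_at /=; split => //.
  exact: cut_lt.
by rewrite /k; case: eqP; [left|right].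
Qed.

End Cut.

Lemma le_limit_clock x y : x <= y -> pos x = 0 -> limit_time y (clock x).
Proof. by move=> xy /pos0_limit; apply: (le_limit xy). Qed.

Lemma le_eq_cut x y : y <= x -> y = cut x (clock y) (pos y).
Proof.
move=> yx; have xy := le_on yx; have yl := le_limit_clock yx.
have py := pos_ge0 y; apply: point_eq => [v|]; last by rewrite clock_cut.
case: (ltgtP v (clock y)) => [vy|vy|->].
- by rewrite cut_lt // (le_agree yx).
- by apply: off_eq; apply: off_gt; rewrite ?clock_cut.
rewrite cut_at // [LHS]surjective_pairing -/(pos y); congr pair.
case: eqP => [/(valid_end0 (pointP y)) //|/eqP py0].
by apply: (le_index yx); rewrite lt_neqAle eq_sym py0.
Qed.

Lemma cut_eq x z w u : (forall v, v < w -> x v = z v) ->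
  u = 0 \/ (x w).1 = (z w).1 -> cut x w u = cut z w u.
Proof.
move=> xz kE; rewrite /cut.
have -> : (if u == 0 then k0 else (x w).1) = (if u == 0 then k0 else (z w).1).
  by case: kE => ->; rewrite ?eqxx.
rewrite /ext; suff -> : forall k, exth x w k u = exth z w k u by [].
by move=> k; apply/funext => v; rewrite /exth; case: ifP => // /xz.
Qed.

Lemma cut_mono x w u u' : 0 <= (x w).2 -> (u = 0 -> limit_time x w) ->
  0 <= u -> u <= u' -> cut x w u <= cut x w u'.
Proof.
move=> xw ul u0 uu'; have u'0 := le_trans u0 uu'.
have u'l : u' = 0 -> limit_time x w.
  by move=> u'E; apply: ul; apply/eqP; rewrite eq_le u0 -u'E uu'.
apply/lepP; rewrite /le_point clock_cut // pos_cut // !cut_at //=; split=> //.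
  by move=> v vw; rewrite !cut_lt.
have [|/eqP un] := eqVneq u 0; [by left|right].
by rewrite ifF //; apply/eqP => u'E; apply: un; apply/eqP; rewrite eq_le u0 -u'E uu'.
Qed.

Lemma eq_point x y : clock x = clock y -> pos x = pos y -> x <= y -> x = y.
Proof.
move=> sE pE xy; apply/le_anti; rewrite xy /=; apply/lepP; split.
- by move=> v vy; rewrite (le_agree xy) // sE.
- by rewrite -sE -/(pos x) pE.
- have := pos_ge0 y; rewrite le_eqVlt => /orP[/eqP <-|py]; [by left|right].
  by rewrite -sE (le_index xy) ?pE // sE.
Qed.

Lemma lt_pos x z : x < z -> clock x = clock z -> pos x < pos z.
Proof.
move=> xz sE; rewrite lt_neqAle; have /ltW/le_pos := xz; rewrite sE -/(pos z) => ->.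
rewrite andbT; apply/eqP => pE.
by have := eq_point sE pE (ltW xz) => xzE; move: xz; rewrite xzE ltxx.
Qed.

(** * Directions *)

(* If [y < z], then the part of [z] just above [y] lies on the ray that is
   entered at time [dir_time y z] with index [dir_index y z], above the height
   [dir_height y z]. *)
Definition straight y z : bool := pos y < (z (clock y)).2.
Definition dir_time y z := if straight y z then clock y else nxt y (clock y).
Definition dir_height y z := if straight y z then pos y else 0.
Definition dir_index y z := (z (dir_time y z)).1.

(** In this case [z] leaves the last ray of [y] exactly at [y]. *)
Lemma not_straight y z : y < z -> ~~ straight y z ->
  [/\ clock y < clock z, 0 < pos y & z (clock y) = y (clock y)].
Proof.
move=> yz; rewrite /straight -leNgt => zy.
have pE : (z (clock y)).2 = pos y.
  by apply/eqP; rewrite eq_le zy le_pos // ltW.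
have sE : clock y < clock z.
  rewrite lt_neqAle le_clock ?ltW // andbT; apply/eqP => sE.
  by have := lt_pos yz sE; rewrite /pos -sE pE ltxx.
have py : 0 < pos y.
  have [+ _] := valid_nxt (pointP z) sE (le_on (ltW yz)).
  by rewrite pE.
split=> //; rewrite [LHS]surjective_pairing [RHS]surjective_pairing pE.
by rewrite (le_index (ltW yz)).
Qed.

Lemma dir_on y z : y < z -> [/\ 0 <= (z (dir_time y z)).2, 0 <= dir_height y z,
  dir_height y z < (z (dir_time y z)).2 &
  forall v, v < dir_time y z -> z v = y v].
Proof.
move=> yz; rewrite /dir_time /dir_height; case: ifP => [st|/negbT nst].
  split; rewrite ?pos_ge0 //; first exact: le_on (ltW yz).
  by move=> v vy; rewrite (le_agree (ltW yz)).
have [sE py zE] := not_straight yz nst.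
have zy : 0 <= (z (clock y)).2 by exact: le_on (ltW yz).
have nE : nxt y (clock y) = nxt z (clock y) by rewrite /nxt zE.
have zn : 0 <= (z (nxt y (clock y))).2 by rewrite nE on_nxt.
split => //.
  have [lim|[v [_ _ _ _ //]]] := limit_or_nxt zn.
  by case: (lim (clock y)) => //; rewrite nxt_gt.
move=> v vn; case: (ltgtP v (clock y)) => [vy|vy|-> //].
  by rewrite (le_agree (ltW yz)).
apply: off_eq; last exact: off_gt.
by apply: (valid_gap (pointP z) sE zy); rewrite vy -nE.
Qed.

Lemma dir_time_ge y z : clock y <= dir_time y z.
Proof. by rewrite /dir_time; case: ifP => // _; rewrite ltW // nxt_gt. Qed.

Lemma dir_cut y z u : y < z -> dir_height y z < u -> u <= (z (dir_time y z)).2 ->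
  y < cut z (dir_time y z) u /\ cut z (dir_time y z) u <= z.
Proof.
move=> yz au uz; have [zw a0 _ _] := dir_on yz.
have u_gt0 := le_lt_trans a0 au; have u0 := ltW u_gt0.
have ul : u = 0 -> limit_time z (dir_time y z) by move=> uE; move: u_gt0; rewrite uE ltxx.
split; last by apply: cut_le.
have cz : cut z (dir_time y z) u <= z by apply: cut_le.
have [//|cy] := le_total_below (ltW yz) cz; last first.
  have := le_clock cy; rewrite clock_cut // => sy.
  have wE : dir_time y z = clock y by apply/eqP; rewrite eq_le sy dir_time_ge.
  have := le_pos cy; rewrite clock_cut // pos_cut //; rewrite wE -/(pos y).
  move: au wE; rewrite /dir_time /dir_height; case: ifP => _.
    by move=> pu _; rewrite leNgt pu.
  by move=> _ wE; move: (nxt_gt y (clock y)); rewrite wE ltxx.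
rewrite lt_neqAle => yc; rewrite yc andbT; apply/eqP => yE.
have sE : clock y = dir_time y z by rewrite [in LHS]yE clock_cut.
have pE : pos y = u by rewrite [in LHS]yE pos_cut.
move: au sE; rewrite /dir_time /dir_height; case: ifP => _; first by rewrite pE ltxx.
by move=> _ sE; move: (nxt_gt y (clock y)); rewrite -sE ltxx.
Qed.

(** With [dir_cut] this identifies the part of a branch just above [y] with an interval of heights,
    so that an automorphism induces a map between real intervals. *)
Lemma dir_below y z x b : y < z -> dir_height y z < b -> b <= (z (dir_time y z)).2 ->
  y < x -> x <= cut z (dir_time y z) b ->
  exists2 u, dir_height y z < u <= b & x = cut z (dir_time y z) u.
Proof.
move=> yz ab bz yx xc; have [zw a0 _ _] := dir_on yz.
have b_gt0 := le_lt_trans a0 ab; have b0 := ltW b_gt0.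
have bl : b = 0 -> limit_time z (dir_time y z) by move=> bE; move: b_gt0; rewrite bE ltxx.
have cz : cut z (dir_time y z) b <= z by apply: cut_le.
have xz := le_trans xc cz.
have sxw : clock x <= dir_time y z by have := le_clock xc; rewrite clock_cut.
have syx := le_clock (ltW yx).
have pxc := le_pos xc.
have sx : clock x = dir_time y z.
  apply/eqP; rewrite eq_le sxw /=; move: sxw; rewrite /dir_time.
  case: ifP => // /negbT nst _; have [sE py zE] := not_straight yz nst.
  have nE : nxt y (clock y) = nxt z (clock y) by rewrite /nxt zE.
  rewrite nE; apply: nxt_le_on; [exact: le_on (ltW yz)|exact: le_on|].
  rewrite lt_neqAle syx andbT; apply/eqP => sxy.
  have := lt_pos yx sxy; rewrite ltNge.
  by have := le_pos xz; rewrite -sxy zE -/(pos y) => ->.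
exists (pos x); last by rewrite -sx; exact: le_eq_cut.
rewrite sx cut_at // in pxc; rewrite pxc andbT.
move: sx; rewrite /dir_time /dir_height; case: ifP => [_ /esym sxy|/negbT nst sx].
  exact: lt_pos.
have xw : 0 <= (x (clock x)).2 by exact: pos_ge0.
have [lim|[v [_ _ _ _ //]]] := limit_or_nxt xw.
have [sE py zE] := not_straight yz nst.
have sxy : clock y < clock x by rewrite sx nxt_gt.
case: (lim (clock y)) => //; first exact: le_on (ltW yx).
by rewrite sx /nxt (le_agree xz) // zE.
Qed.

Lemma straight_mono y x z : y < x -> x <= z -> straight y x = straight y z.
Proof.
move=> yx xz; rewrite /straight; have := le_clock (ltW yx).
rewrite le_eqVlt => /orP[/eqP sE|sE]; last by rewrite (le_agree xz).
rewrite [in LHS]sE -/(pos x) (lt_pos yx sE); apply/esym.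
by apply: lt_le_trans (lt_pos yx sE) _; rewrite sE le_pos.
Qed.

Lemma dir_mono y x z : y < x -> x <= z ->
  dir_time y x = dir_time y z /\ dir_index y x = dir_index y z.
Proof.
move=> yx xz; have tE : dir_time y x = dir_time y z.
  by rewrite /dir_time (straight_mono yx xz).
split=> //; rewrite /dir_index -tE.
have [xw a0 ax _] := dir_on yx.
have := on_le xw; rewrite le_eqVlt => /orP[/eqP sE|sE]; last by rewrite (le_agree xz).
by rewrite sE (le_index xz) // /pos -sE (le_lt_trans a0).
Qed.

Lemma dir_time_straight y x z : dir_time y x = dir_time y z ->
  straight y x = straight y z.
Proof.
rewrite /dir_time; case: ifP; case: ifP => // _ _ /eqP;
  by rewrite ?(gt_eqF (nxt_gt _ _)) ?(lt_eqF (nxt_gt _ _)).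
Qed.

Lemma dir_common y x z : y < x -> y < z -> dir_time y x = dir_time y z ->
  dir_index y x = dir_index y z -> exists2 m, y < m & m <= x /\ m <= z.
Proof.
move=> yx yz tE kE; have [_ a0 ax axy] := dir_on yx; have [_ _ az azy] := dir_on yz.
have aE : dir_height y x = dir_height y z.
  by rewrite /dir_height (dir_time_straight tE).
pose u := Num.min (x (dir_time y x)).2 (z (dir_time y z)).2.
have au : dir_height y x < u by rewrite lt_min ax aE az.
have ux : u <= (x (dir_time y x)).2 by rewrite ge_min lexx.
have uz : u <= (z (dir_time y z)).2 by rewrite ge_min lexx orbT.
have [yc cx] := dir_cut yx au ux; rewrite aE in au.
have [_ cz] := dir_cut yz au uz.
exists (cut x (dir_time y x) u) => //; split=> //.
suff -> : cut x (dir_time y x) u = cut z (dir_time y z) u by [].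
rewrite -tE; apply: cut_eq; last by right; rewrite {2}tE.
by move=> v vw; rewrite axy // azy // -tE.
Qed.

Lemma same_componentP y x z : y < x -> y < z ->
  same_component y x z <-> dir_time y x = dir_time y z /\ dir_index y x = dir_index y z.
Proof.
move=> yx yz; split=> [[m [ym mx mz]]|[tE kE]].
  have [tx kx] := dir_mono ym mx; have [tz kz] := dir_mono ym mz.
  by rewrite -tx -kx -tz -kz.
by have [m ym [mx mz]] := dir_common yx yz tE kE; exists m.
Qed.

(** * Tree order, meets and degrees *)

Lemma tree_order_point : tree_order point.
Proof.
split; last by exists root; split=> // x _; exact: root_le.
by move=> x y z yx zx; exact: le_total_below yx zx.
Qed.

Lemma le_same_clock x m z : m <= x -> z <= x -> clock z = clock m -> pos z <= pos m ->
  z <= m.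
Proof.
move=> mx zx sE pzm; have [//|mz] := le_total_below zx mx.
have := le_pos mz; rewrite -sE -/(pos z) => pmz.
by rewrite (eq_point (esym sE) _ mz) //; apply/eqP; rewrite eq_le pmz pzm.
Qed.

(** At the first difference [w], if both follow the same ray or [x] stops at height [0], the meet is
    where the lower one leaves or ends. Otherwise it is the point of height [0] if [w] is a limit
    time, and else the point where the preceding ray is left. *)
Lemma meet_exists x y : exists m, is_max [set z | z <= x /\ z <= y] m.
Proof.
have [w [xw yw axy dxy]] := first_difference x y.
wlog xyw : x y xw yw axy dxy / (x w).2 <= (y w).2.
  move=> H; have [/H|/ltW yxw] := leP (x w).2 (y w).2; first exact.
  have ayx v : v < w -> y v = x v by move=> vw; rewrite axy.
  have dyx : y w <> x w \/ (w = clock y \/ w = clock x).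
    by case: dxy => [nxy|[]]; [left => yx; apply: nxy|right; right|right; left].
  have [m [[my mx] mmax]] := H y x yw xw ayx dyx yxw.
  by exists m; split=> // z [zx zy]; apply: mmax.
have nlt z : z <= x -> z <= y -> clock z <= w.
  move=> zx zy; rewrite leNgt; apply/negP => wz; case: dxy => [|[wE|wE]].
  - by apply; rewrite -(le_agree zx) // -(le_agree zy).
  - by have := le_clock zx; rewrite leNgt -wE wz.
  - by have := le_clock zy; rewrite leNgt -wE wz.
have maxI m : m <= x -> m <= y -> (forall z, z <= x -> z <= y -> m <= z ->
    clock z = clock m /\ pos z <= pos m) -> is_max [set z | z <= x /\ z <= y] m.
  move=> mx my H; split=> // z [zx zy].
  have [//|mz] := le_total_below zx mx.
  by have [sE pE] := H z zx zy mz; exact: le_same_clock mx zx sE pE.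
have [kE|/not_orP[/eqP xw0 nk]] :=
    pselect ((x w).2 = 0 \/ (x w).1 = (y w).1).
  have xl : (x w).2 = 0 -> limit_time x w.
    move=> xw0; have [//|[v [_ _ _ _]]] := limit_or_nxt xw.
    by rewrite xw0 ltxx.
  have yl : (x w).2 = 0 -> limit_time y w.
    move=> /xl lim v vw; rewrite /nxt -axy //; exact: lim.
  have cE := cut_eq axy kE.
  exists (cut x w (x w).2); apply: maxI; first exact: cut_le.
    by rewrite cE; apply: cut_le.
  move=> z zx zy mz; have := le_clock mz; rewrite clock_cut // => wz.
  have sz : clock z = w by apply/eqP; rewrite eq_le wz nlt.
  by split=> //; rewrite pos_cut // -sz; exact: le_pos.
have xw_gt0 : 0 < (x w).2 by rewrite lt_neqAle eq_sym xw0.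
have yw_gt0 := lt_le_trans xw_gt0 xyw.
have pos0 z : z <= x -> z <= y -> clock z = w -> pos z = 0.
  move=> zx zy sz; apply/eqP; rewrite eq_le pos_ge0 andbT leNgt; apply/negP => pz.
  by apply: nk; rewrite -sz -(le_index zx pz) (le_index zy pz).
have [lim|[v [vw xv vE kw _]]] := limit_or_nxt xw.
  have liy : limit_time y w by move=> v vw; rewrite /nxt -axy //; exact: lim.
  exists (cut x w 0); apply: maxI; first exact: cut_le.
    by rewrite (cut_eq (z := y)) //; [apply: cut_le|left].
  move=> z zx zy mz; have := le_clock mz; rewrite clock_cut // => wz.
  have sz : clock z = w by apply/eqP; rewrite eq_le wz nlt.
  by split=> //; rewrite pos_cut // (pos0 z).
have vs := lt_le_trans vw (on_le xw).
have [xv_gt0 _] := valid_nxt (pointP x) vs xv.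
have xl : (x v).2 = 0 -> limit_time x v by move=> xv0; rewrite xv0 ltxx in xv_gt0.
have yl : (x v).2 = 0 -> limit_time y v by move=> xv0; rewrite xv0 ltxx in xv_gt0.
have yv : 0 <= (y v).2 by rewrite -axy.
exists (cut x v (x v).2); apply: maxI; first exact: cut_le.
  rewrite (cut_eq (z := y)); last by right; rewrite axy.
    by apply: cut_le => //; rewrite axy.
  by move=> r rv; rewrite axy // (lt_trans rv).
move=> z zx zy mz; have := le_clock mz; rewrite clock_cut // => vz.
have sz : clock z = v.
  apply/eqP; rewrite eq_le vz andbT leNgt; apply/negP => vz'.
  have := nxt_le_on xv (le_on zx) vz'; rewrite vE => wz.
  have szw : clock z = w by apply/eqP; rewrite eq_le wz nlt.
  have := pos0_limit (pos0 z zx zy szw); move=> /(_ v vz').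
  by rewrite szw /nxt (le_agree zx) //; apply.
by split=> //; rewrite pos_cut // -sz; exact: le_pos.
Qed.

(** * Degrees *)

Lemma growE x k u : pos x < u -> pos x = 0 \/ k = (x (clock x)).1 ->
  [/\ clock (ext x (clock x) k u) = clock x, pos (ext x (clock x) k u) = u,
   forall v, v < clock x -> ext x (clock x) k u v = x v &
   ext x (clock x) k u (clock x) = (k, u)].
Proof.
move=> pu kx; have u_gt0 := le_lt_trans (pos_ge0 x) pu.
have xw : extendable x (clock x) by left; exact: pos_ge0.
have u0 : u = 0 -> k = k0 by move=> uE; move: u_gt0; rewrite uE ltxx.
have lk : limit_time x (clock x) \/ k <> k0.
  case: kx => [/pos0_limit|->]; first by left.
  by have [|[v [_ _ _ ? _]]] := limit_or_nxt (pos_ge0 x); [left|right].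
have u_ge0 := ltW u_gt0.
by split=> [||v vx|]; [apply: clock_ext|apply: pos_ext|apply: ext_lt|apply: ext_at].
Qed.

Lemma dir_grow x k u : pos x < u -> pos x = 0 \/ k = (x (clock x)).1 ->
  let y := ext x (clock x) k u in
  [/\ x < y, dir_time x y = clock x & dir_index x y = k].
Proof.
move=> pu kx y; have [sy _ ay ey] := growE pu kx; rewrite -/y in sy ay ey.
have st : straight x y by rewrite /straight ey.
split; last 2 first.
- by rewrite /dir_time st.
- by rewrite /dir_index /dir_time st ey.
rewrite lt_neqAle; apply/andP; split.
  by apply/eqP => xy; move: st; rewrite /straight -xy -/(pos x) ltxx.
apply/lepP; split=> [v vx||]; [by rewrite ay|by rewrite ey; exact: ltW|rewrite ey].
by case: kx => [->|->]; [left|right].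
Qed.

Lemma dir_branch x k u : 0 < pos x -> 0 < u -> k <> k0 ->
  let y := ext x (nxt x (clock x)) k u in
  [/\ x < y, dir_time x y = nxt x (clock x) & dir_index x y = k].
Proof.
move=> px u_gt0 kk0 y.
have xw : extendable x (nxt x (clock x)) by right.
have u0 : u = 0 -> k = k0 by move=> uE; move: u_gt0; rewrite uE ltxx.
have lk : limit_time x (nxt x (clock x)) \/ k <> k0 by right.
have [sy ay ey] : [/\ clock y = nxt x (clock x),
    forall v, v < nxt x (clock x) -> y v = x v & y (nxt x (clock x)) = (k, u)].
  by split=> [|v vx|]; [apply: clock_ext|apply: ext_lt|apply: ext_at] => //; exact: ltW.
have st : straight x y = false by rewrite /straight ay ?nxt_gt // ltxx.
split; last 2 first.
- by rewrite /dir_time st.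
- by rewrite /dir_index /dir_time st ey.
rewrite lt_neqAle; apply/andP; split.
  by apply/eqP => xy; have := nxt_gt x (clock x); rewrite -sy -xy ltxx.
apply/lepP; split=> [v vx||]; rewrite ?ay ?nxt_gt //; last by right.
exact: lt_trans vx (nxt_gt _ _).
Qed.

(** One point is chosen in each component above [x]. At height [0] the label [k] is the index of the
    ray that is climbed; at positive height [k0] stands for staying on the ray, which is why a ray
    entered on leaving another never has index [k0]. *)
Definition branch_point x k : point :=
  if pos x == 0 then ext x (clock x) k 1
  else if `[< k = k0 >] then ext x (clock x) (x (clock x)).1 (pos x + 1)
  else ext x (nxt x (clock x)) k 1.

Lemma branch_point_gt x k : x < branch_point x k.
Proof.
rewrite /branch_point; case: eqP => [px|/eqP px].
  by have [||] := @dir_grow x k 1; rewrite ?px //; left.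
have px_gt0 : 0 < pos x by rewrite lt_neqAle eq_sym px pos_ge0.
case: asboolP => kk0.
  by have [||] := @dir_grow x (x (clock x)).1 (pos x + 1); [rewrite ltrDl|right|].
by have [] := dir_branch px_gt0 ltr01 kk0.
Qed.

Lemma branch_point_dir_inj x k k' :
  dir_time x (branch_point x k) = dir_time x (branch_point x k') ->
  dir_index x (branch_point x k) = dir_index x (branch_point x k') -> k = k'.
Proof.
rewrite /branch_point; case: eqP => [px|/eqP px].
  have h c : pos x = 0 \/ c = (x (clock x)).1 by left.
  have lt1 : pos x < 1 by rewrite px.
  have [_ _ ->] := dir_grow lt1 (h k); by have [_ _ ->] := dir_grow lt1 (h k').
have px_gt0 : 0 < pos x by rewrite lt_neqAle eq_sym px pos_ge0.
have [|//|_ gt gk] := @dir_grow x (x (clock x)).1 (pos x + 1); first by rewrite ltrDl.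
  by right.
have nE : clock x == nxt x (clock x) = false by rewrite lt_eqF ?nxt_gt.
case: asboolP => kk0; case: asboolP => k'k0.
- by rewrite kk0 k'k0.
- by have [_ -> _] := dir_branch px_gt0 ltr01 k'k0; rewrite gt => /eqP; rewrite nE.
- have [_ -> _] := dir_branch px_gt0 ltr01 kk0.
  by rewrite gt => /esym/eqP; rewrite nE.
- have [_ _ ->] := dir_branch px_gt0 ltr01 kk0.
  by have [_ _ ->] := dir_branch px_gt0 ltr01 k'k0.
Qed.

Lemma branch_point_surj x y : x < y -> exists k,
  dir_time x (branch_point x k) = dir_time x y /\
  dir_index x (branch_point x k) = dir_index x y.
Proof.
move=> xy; have := pos_ge0 x; rewrite le_eqVlt => /orP[/eqP px|px_gt0].
  have lt1 : pos x < 1 by rewrite -px.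
  have h c : pos x = 0 \/ c = (x (clock x)).1 by left.
  exists (dir_index x y); rewrite /branch_point -px eqxx.
  have [_ -> ->] := dir_grow lt1 (h (dir_index x y)); split=> //.
  rewrite /dir_time; case: ifP => // /negbT /(not_straight xy)[_].
  by rewrite -px ltxx.
case: (boolP (straight x y)) => st.
  exists k0; rewrite /branch_point gt_eqF // asboolT //.
  have [|//|_ -> ->] := @dir_grow x (x (clock x)).1 (pos x + 1); first by rewrite ltrDl.
    by right.
  by rewrite /dir_index /dir_time st (le_index (ltW xy)).
have [sE _ yE] := not_straight xy st.
have kk0 : dir_index x y <> k0.
  rewrite /dir_index /dir_time (negbTE st).
  have := valid_new (pointP y) sE; rewrite /nxt yE; apply; exact: pos_ge0.
exists (dir_index x y); rewrite /branch_point gt_eqF // asboolF //.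
have [_ -> ->] := dir_branch px_gt0 ltr01 kk0.
by rewrite /dir_time (negbTE st).
Qed.

Lemma uniformly_branching_point : uniformly_branching point K.
Proof.
move=> x; pose F k := [set z | x < z /\ same_component x (branch_point x k) z].
suff -> : components x = F @` setT.
  apply: inj_card_eq => k k' _ _ FE.
  have : F k' (branch_point x k').
    split; first exact: branch_point_gt.
    by apply/same_componentP; rewrite ?branch_point_gt.
  rewrite -FE => -[_ /same_componentP[]]; rewrite ?branch_point_gt //.
  exact: branch_point_dir_inj.
have FE k y : x < y -> dir_time x (branch_point x k) = dir_time x y ->
    dir_index x (branch_point x k) = dir_index x y ->
    F k = [set z | x < z /\ same_component x y z].
  move=> xy tE kE; have xb := branch_point_gt x k.
  apply/seteqP; split=> z [xz] => [/(same_componentP xb xz)|/(same_componentP xy xz)];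
    rewrite ?tE ?kE => tkz; split=> //.
    exact/(same_componentP xy xz).
  by apply/(same_componentP xb xz); rewrite tE kE.
apply/seteqP; split=> [_ [y xy <-]|_ [k _ <-]].
  by have [k [tE kE]] := branch_point_surj xy; exists k => //; exact: FE.
by exists (branch_point x k) => //; exact: branch_point_gt.
Qed.

(** * Branches are real intervals *)

Section Branch.
Variable A : set point.
Hypothesis branchA : is_branch A.

Let chainA x y : A x -> A y -> x <= y \/ y <= x.
Proof. by move=> Ax Ay; apply: branchA.1. Qed.

Let addA y : (forall x, A x -> x <= y \/ y <= x) -> A y.
Proof.
move=> Ay; suff <- : A `|` [set y] = A by right.
apply: branchA.2; last by left.
move=> x z [Ax|->] [Az|->]; [exact: chainA|exact: Ay| |by left].
exact/or_comm/Ay.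
Qed.

Lemma branch_root : A root.
Proof. by apply: addA => x _; right; exact: root_le. Qed.

Lemma branch_below x y : A x -> y <= x -> A y.
Proof.
move=> Ax yx; apply: addA => z Az; have [zx|xz] := chainA Az Ax.
  exact: le_total_below zx yx.
by right; exact: le_trans xz.
Qed.

(** A point of the branch that has left the ray of [x]; the default [x] fails the clock test in
    [coord] and so signals the last ray. *)
Let leave x := xget x [set q | [/\ A q, x <= q & clock x < clock q]].

(* Coordinate along the branch: the ray entered at time [v] and left at time
   [v'] is mapped linearly onto [v, v']. *)
Let coord x : R := let q := leave x in
  if clock x < clock q
  then clock x + (nxt q (clock x) - clock x) * (pos x / (q (clock x)).2)
  else clock x + pos x.

Let coord_leave x q : A q -> x <= q -> clock x < clock q ->
  coord x = clock x + (nxt q (clock x) - clock x) * (pos x / (q (clock x)).2).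
Proof.
move=> Aq xq sq.
have [Al xl sl] : [/\ A (leave x), x <= leave x & clock x < clock (leave x)].
  by apply: (@xgetPex _ x [set q | [/\ A q, x <= q & clock x < clock q]]); exists q.
rewrite /coord /= sl /nxt; suff -> : leave x (clock x) = q (clock x) by [].
by have [lq|ql] := chainA Al Aq; [rewrite (le_agree lq)|rewrite (le_agree ql)].
Qed.

Let coord_last x : (forall q, A q -> x <= q -> clock q <= clock x) ->
  coord x = clock x + pos x.
Proof.
move=> H; rewrite /coord /= /leave; case: xgetP => [q _ [Aq xq]|_].
  by rewrite ltNge H.
by rewrite ltxx.
Qed.

Let leave_or_last x : (exists q, [/\ A q, x <= q & clock x < clock q]) \/
  (forall q, A q -> x <= q -> clock q <= clock x).
Proof.
have [|nq] := pselect (exists q, [/\ A q, x <= q & clock x < clock q]); first by left.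
right=> q Aq xq; rewrite leNgt; apply/negP => sq; apply: nq; by exists q.
Qed.

Let coord_bounds x q : A q -> x <= q -> clock x < clock q ->
  [/\ 0 < (q (clock x)).2, nxt q (clock x) <= clock q, clock x <= coord x,
      coord x <= nxt q (clock x) &
      pos x < (q (clock x)).2 -> coord x < nxt q (clock x)].
Proof.
move=> Aq xq sq; have [qs nq] := valid_nxt (pointP q) sq (le_on xq).
have n0 : 0 < nxt q (clock x) - clock x by rewrite subr_gt0 nxt_gt.
rewrite (coord_leave Aq xq sq); split=> //.
- by rewrite lerDl mulr_ge0 ?divr_ge0 ?pos_ge0 // ltW.
- by rewrite -lerBrDl ger_pMr // ler_pdivrMr // mul1r le_pos.
- by move=> pq; rewrite -ltrBrDl gtr_pMr // ltr_pdivrMr // mul1r.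
Qed.

Let coord_ge x : clock x <= coord x.
Proof.
have [[q [Aq xq sq]]|H] := leave_or_last x; first by have [] := coord_bounds Aq xq sq.
by rewrite coord_last // lerDl pos_ge0.
Qed.

Let coord_gt x : 0 < pos x -> clock x < coord x.
Proof.
move=> px; have [[q [Aq xq sq]]|H] := leave_or_last x; last first.
  by rewrite coord_last // ltrDl.
have [qs _ _ _ _] := coord_bounds Aq xq sq.
by rewrite (coord_leave Aq) // ltrDl mulr_gt0 ?divr_gt0 // subr_gt0 nxt_gt.
Qed.

Let coord_lt x y : A x -> A y -> x < y -> coord x < coord y.
Proof.
move=> Ax Ay xy; have xy' := ltW xy; have := le_clock xy'.
rewrite le_eqVlt => /orP[/eqP sE|sxy].
  have pxy := lt_pos xy sE.
  have [[q [Aq yq sq]]|H] := leave_or_last y.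
    have xq := le_trans xy' yq; have sxq : clock x < clock q by rewrite sE.
    rewrite (coord_leave Aq xq sxq) (coord_leave Aq yq sq) sE ltrD2l.
    have [qs _ _ _ _] := coord_bounds Aq yq sq.
    by rewrite ltr_pM2l ?subr_gt0 ?nxt_gt // ltr_pM2r ?invr_gt0.
  rewrite (coord_last H) (coord_last (x := x)) ?sE ?ltrD2l // => q Aq xq.
  by have [yq|qy] := chainA Ay Aq; [exact: H|exact: le_clock].
have [ys ny xc cx cx'] := coord_bounds Ay xy' sxy.
have := le_pos xy'; rewrite le_eqVlt => /orP[/eqP pE|pxy]; last first.
  by apply: lt_le_trans (cx' pxy) _; apply: le_trans ny (coord_ge y).
apply: le_lt_trans cx _; move: ny; rewrite le_eqVlt => /orP[/eqP nE|ny]; last first.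
  exact: lt_le_trans ny (coord_ge y).
(* Now [y] lies on the ray entered on leaving that of [x], where all heights are positive. *)
rewrite nE; apply: coord_gt; have [lim|[v [_ _ _ _ //]]] := limit_or_nxt (pos_ge0 y).
by case: (lim (clock x)) => //; exact: le_on.
Qed.

(** The entry time of a ray is attained at its point of height [0] if it is a limit time, and
    otherwise where the preceding ray is left. *)
Let coord_at_time x v : A x -> 0 <= (x v).2 -> exists2 y, A y & coord y = v.
Proof.
move=> Ax xv; have [lim|[w [wv xw wE _ _]]] := limit_or_nxt xv.
  have yx : cut x v 0 <= x by apply: cut_le.
  exists (cut x v 0); first exact: branch_below yx.
  have [[q [Aq yq sq]]|H] := leave_or_last (cut x v 0).
    by rewrite (coord_leave Aq) // pos_cut // clock_cut // mul0r mulr0 addr0.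
  by rewrite coord_last // pos_cut // clock_cut // addr0.
have wx := lt_le_trans wv (on_le xv).
have [xw_gt0 _] := valid_nxt (pointP x) wx xw.
have lw : (x w).2 = 0 -> limit_time x w by move=> xw0; rewrite xw0 ltxx in xw_gt0.
have yx : cut x w (x w).2 <= x by apply: cut_le.
exists (cut x w (x w).2); first exact: branch_below yx.
rewrite (coord_leave Ax) // ?pos_cut // ?clock_cut // divff ?gt_eqF // mulr1.
by rewrite addrC subrK.
Qed.

Let coord_surj x r : A x -> 0 <= r -> r <= coord x -> exists2 y, A y & coord y = r.
Proof.
move=> Ax r0 rx; have [rs|] := ltP r (clock x).
  have [|v [xv /andP[]]] := valid_cover (pointP x) (u := r); first by rewrite r0.
  rewrite le_eqVlt => /orP[/eqP <- _|vr rn]; first exact: coord_at_time Ax xv.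
  have vs := lt_trans vr rs; have [xv_gt0 _] := valid_nxt (pointP x) vs xv.
  have n_gt0 : 0 < nxt x v - v by rewrite subr_gt0 nxt_gt.
  (* The height that the linear map of this ray sends to [r]. *)
  pose u := (x v).2 * ((r - v) / (nxt x v - v)).
  have u_gt0 : 0 < u by rewrite mulr_gt0 // divr_gt0 // subr_gt0.
  have u0 := ltW u_gt0.
  have ul : u = 0 -> limit_time x v by move=> uE; rewrite uE ltxx in u_gt0.
  have yx : cut x v u <= x.
    apply: cut_le => //; rewrite /u ger_pMr // ler_pdivrMr // mul1r.
    by rewrite lerD2r ltW.
  exists (cut x v u); first exact: branch_below yx.
  rewrite (coord_leave Ax) // ?pos_cut // ?clock_cut // /u.
  rewrite [_ / (x v).2]mulrAC divff ?gt_eqF // mul1r mulrC divfK ?gt_eqF //.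
  by rewrite addrC subrK.
rewrite le_eqVlt => /orP[/eqP <-|sr]; first exact: coord_at_time Ax (pos_ge0 x).
have [[q [Aq xq sq]]|H] := leave_or_last x.
  have n_gt0 : 0 < nxt q (clock x) - clock x by rewrite subr_gt0 nxt_gt.
  have [qs _ _ _ _] := coord_bounds Aq xq sq.
  pose u := (q (clock x)).2 * ((r - clock x) / (nxt q (clock x) - clock x)).
  have u_gt0 : 0 < u by rewrite mulr_gt0 // divr_gt0 // subr_gt0.
  have u0 := ltW u_gt0.
  have ul : u = 0 -> limit_time q (clock x) by move=> uE; rewrite uE ltxx in u_gt0.
  have yq : cut q (clock x) u <= q.
    apply: cut_le => //; first exact: le_on.
    rewrite /u ger_pMr // ler_pdivrMr // mul1r lerD2r.
    by apply: le_trans rx _; have [] := coord_bounds Aq xq sq.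
  exists (cut q (clock x) u); first exact: branch_below yq.
  have qon := le_on xq.
  rewrite (coord_leave Aq) // ?pos_cut // ?clock_cut // /u.
  rewrite [_ / (q _).2]mulrAC divff ?gt_eqF // mul1r mulrC divfK ?gt_eqF //.
  by rewrite addrC subrK.
rewrite (coord_last H) -lerBlDl in rx.
pose u := r - clock x; have u_gt0 : 0 < u by rewrite subr_gt0.
have u0 := ltW u_gt0.
have ul : u = 0 -> limit_time x (clock x) by move=> uE; rewrite uE ltxx in u_gt0.
have yx : cut x (clock x) u <= x by apply: cut_le; rewrite ?pos_ge0.
have xon : 0 <= (x (clock x)).2 by exact: pos_ge0.
exists (cut x (clock x) u); first exact: branch_below yx.
rewrite coord_last ?pos_cut ?clock_cut //; first by rewrite addrC subrK.
move=> q Aq _; have [qx|xq] := chainA Aq Ax; [exact: le_clock|exact: H].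
Qed.

(** The image of [coord] is a nonempty initial segment of the half-line from [0], so it is
    unbounded, or contains its supremum, or just misses it. *)
Lemma branch_iso : exists (I : interval R) (f : point -> R), order_iso_on A [set` I] f.
Proof.
have coord_le x y : A x -> A y -> (coord x <= coord y) = (x <= y).
  move=> Ax Ay; have [xy|yx] := chainA Ax Ay.
    rewrite xy; move: xy; rewrite le_eqVlt => /orP[/eqP ->|xy]; first exact: lexx.
    exact/ltW/coord_lt.
  move: yx; rewrite le_eqVlt => /orP[/eqP ->|yx]; first by rewrite !lexx.
  by rewrite (lt_geF yx) leNgt coord_lt.
have inj : {in A &, injective coord}.
  move=> x y /set_mem Ax /set_mem Ay xy; apply/le_anti.
  by rewrite -!coord_le // xy lexx.
suff [I IE] : exists I : interval R, [set` I] = coord @` A.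
  exists I, coord; rewrite IE; split; last exact: coord_le.
  by split=> // [x Ax|r [x Ax <-]]; exists x.
have ge0 x : 0 <= coord x by apply: le_trans (coord_ge x); exact: clock_ge0.
have [bd|nbd] := pselect (has_ubound (coord @` A)); last first.
  exists `[0, +oo[; apply/seteqP; split=> [r|r [x Ax <-]]; rewrite /= in_itv /= andbT //.
  move=> r0; suff [x Ax rx] : exists2 x, A x & r <= coord x.
    by have [y Ay <-] := coord_surj Ax r0 rx; exists y.
  apply: contrapT => nx; apply: nbd; exists r => _ [x Ax <-].
  apply: contrapT => /negP; rewrite -ltNge => rx.
  by apply: nx; exists x => //; exact: ltW.
have hs : has_sup (coord @` A).
  by split=> //; exists (coord root), root => //; exact: branch_root.
pose s := sup (coord @` A).
have les x : A x -> coord x <= s by move=> Ax; apply: sup_upper_bound => //; exists x.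
have lts r : 0 <= r -> r < s -> (coord @` A) r.
  move=> r0 /sup_gt[|_ [x Ax <-] rx]; first by case: hs.
  by have [y Ay <-] := coord_surj Ax r0 (ltW rx); exists y.
have [As|nAs] := pselect ((coord @` A) s).
  exists `[0, s]; apply/seteqP; split=> [r|r [x Ax <-]]; rewrite /= in_itv /=; last first.
    by rewrite ge0 les.
  by move=> /andP[r0]; rewrite le_eqVlt => /orP[/eqP -> //|]; exact: lts.
exists `[0, s[; apply/seteqP; split=> [r|r [x Ax <-]]; rewrite /= in_itv /=.
  by move=> /andP[r0]; exact: lts.
by rewrite ge0 lt_neqAle les // andbT; apply/eqP => xs; apply: nAs; exists x.
Qed.

End Branch.

Lemma branchwise_real_point : branchwise_real_tree point R.
Proof. by split; [exact: tree_order_point|exact: branch_iso|exact: meet_exists]. Qed.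

(** * Limit points *)

(** The union of the paths is defined at all times before the supremum of the clocks, which none of
    them reaches; a new ray is entered at that time and the path ends there at height [0]. *)
Lemma chain_limit (A : set point) (M : R) : A !=set0 ->
  (forall x y, A x -> A y -> x <= y \/ y <= x) ->
  (forall x, A x -> exists2 y, A y & x <= y /\ clock x < clock y) ->
  (forall x, A x -> clock x <= M) ->
  exists z, (forall x, A x -> x <= z) /\ clock z = sup (clock @` A).
Proof.
move=> [x0 Ax0] chA incA bdA; pose s := sup (clock @` A).
have hs : has_sup (clock @` A).
  by split; [exists (clock x0), x0|exists M => _ [x Ax <-]; exact: bdA].
have lts x : A x -> clock x < s.
  move=> Ax; have [y Ay [_ sxy]] := incA _ Ax; apply: lt_le_trans sxy _.
  by apply: sup_upper_bound => //; exists y.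
have agree x y v : A x -> A y -> v < clock x -> v < clock y -> x v = y v.
  by move=> Ax Ay vx vy; have [xy|yx] := chA _ _ Ax Ay;
    [rewrite (le_agree xy)|rewrite (le_agree yx)].
have aboveA v : v < s -> exists2 x, A x & v < clock x.
  by move=> /sup_gt[|_ [x Ax <-] vx]; [case: hs|exists x].
have [f fP] : exists f : R -> point, forall v, v < s -> A (f v) /\ v < clock (f v).
  suff /choice[f fP] : forall v, exists x, v < s -> A x /\ v < clock x by exists f.
  move=> v; have [vs|vs] := ltP v s; last by exists x0.
  by have [x Ax vx] := aboveA v vs; exists x.
pose p v : K * R := if v < s then f v v else if v == s then (k0, 0) else (k0, -1).
have ps : p s = (k0, 0) by rewrite /p ltxx eqxx.
have pA x v : A x -> v < clock x -> p v = x v.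
  move=> Ax vx; have vs := lt_trans vx (lts _ Ax).
  by rewrite /p vs; have [Af vf] := fP v vs; exact: agree.
have pgt v : s < v -> p v = (k0, -1) by move=> sv; rewrite /p ltNge ltW //= gt_eqF.
have s0 : 0 <= s by apply: le_trans (ltW (lts _ Ax0)); exact: clock_ge0.
have pv : valid p s.
  split; rewrite ?ps //.
  - move=> v; have [vs|sv|->] := ltgtP v s; last by rewrite s0.
      have [x Ax vx] := aboveA v vs; rewrite (pA x) // => /on_ge0 ->.
      by [].
    by rewrite pgt //= ler0N1.
  - move=> v; have [vs|sv|->] := ltgtP v s; last by rewrite ps ltxx.
      by have [x Ax vx] := aboveA v vs; rewrite (pA x) // => /(valid_off (pointP x)).
    by rewrite pgt.
  - move=> v vs; have [x Ax vx] := aboveA v vs.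
    rewrite /nxt (pA x) // => xv; have [-> nx] := valid_nxt (pointP x) vx xv.
    by split=> //; apply: le_trans nx (ltW (lts _ Ax)).
  - move=> v u vs; have [x Ax vx] := aboveA v vs.
    rewrite /nxt (pA x) // => xv /andP[vu un].
    have [_ nx] := valid_nxt (pointP x) vx xv.
    rewrite (pA x) ?(lt_le_trans un) //.
    by apply: (valid_gap (pointP x) vx xv); rewrite vu.
  - move=> v vs; have [x Ax vx] := aboveA v vs.
    have [y Ay [xy sxy]] := incA _ Ax; have vy := lt_trans vx sxy.
    rewrite /nxt (pA x) // => xv; have [_ nx] := valid_nxt (pointP x) vx xv.
    rewrite (pA y) ?(le_lt_trans nx) // (agree x y) //.
    by apply: (valid_new (pointP y)) => //; rewrite -(agree x y).
  - move=> u /andP[u0 us]; have [x Ax ux] := aboveA u us.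
    have [|v [xv /andP[vu un]]] := valid_cover (pointP x) (u := u); first by rewrite u0.
    have vx := le_lt_trans vu ux.
    by exists v; rewrite /nxt (pA x) // vu.
exists (Point pv); split=> // x Ax; have [y Ay [xy sxy]] := incA _ Ax.
apply/lepP; split=> /= [v vx||].
- by rewrite (pA x).
- by rewrite (pA y) //; exact: le_pos.
- have [px|px] := eqVneq (pos x) 0; [by left|right].
  by rewrite (pA y) // (le_index xy) // lt_neqAle eq_sym px pos_ge0.
Qed.

(** * Non-gradability *)

Hypothesis col_generic : forall (v : R) k (v' : R) k' (a b : R) h (al be : R), a < b ->
  increasing_on a b h -> convex_image_on a b h ->
  (v, k) <> (v', k') \/ (exists2 t, a < t < b & h t <> t) -> 0 < al -> 0 < be ->
  exists2 t, a < t < b & col v k t = al /\ col v' k' (h t) = be.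

Variable k1 : K.
Hypothesis k1_neq0 : k1 <> k0.

(** Genericity of a ray with respect to itself, a translation being the map that moves points. *)
Lemma col_dense v k a b al : a < b -> 0 < al -> exists2 t, a < t < b & col v k t = al.
Proof.
move=> ab al0; have [|s t y _ _ _ /andP[h1 h2]|||//|t tab [? _]] :=
  @col_generic v k v k a b (fun t => t + 1) al al ab.
- by move=> s t _ st _; rewrite ltrD2r.
- by exists (y - 1); rewrite ?subrK // ltrBrDr ltrBlDr h1.
- by right; exists ((a + b) / 2); [apply/andP; split; lra|move=> ?; lra].
- by [].
- by exists t.
Qed.

(** An increasing function with values in ]0, 2[: positivity lets the root start the construction,
    and the upper bound makes limit points exist. *)
Let phi (r : R) : R := 1 + r / (1 + `|r|).

Let phi_bounds r : 0 < phi r < 2.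
Proof.
have d0 : 0 < 1 + `|r| by rewrite ltr_pwDl.
have : `|r / (1 + `|r|)| < 1.
  by rewrite normrM normfV (gtr0_norm d0) ltr_pdivrMr // mul1r ltrDr.
by rewrite /phi ltr_norml => /andP[h1 h2]; apply/andP; split; lra.
Qed.

Let phi_lt r s : r < s -> phi r < phi s.
Proof.
move=> rs; have d0 t : 0 < 1 + `|t| :> R by rewrite ltr_pwDl.
rewrite ltrD2l ltr_pdivrMr // mulrAC ltr_pdivlMr //.
case: (ger0P r) => r0; case: (ger0P s) => s0; nra.
Qed.

Lemma not_gradable : ~ continuously_gradable point R.
Proof.
move=> [l [l_lt _]].
have l_le x y : x <= y -> phi (l x) <= phi (l y).
  by rewrite le_eqVlt => /orP[/eqP -> //|/l_lt/phi_lt/ltW].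
(* Kurepa's argument: whenever the clock at x is at most phi (l x), the point
   x can be extended so that this remains true and the clock increases. *)
pose T := {x : point | clock x <= phi (l x)}.
(* As the clock must increase strictly, a chain without a maximum satisfies the hypotheses of
   [chain_limit]. *)
pose le' (x y : T) := (x == y) || (val x <= val y) && (clock (val x) < clock (val y)).
have le'P (x y : T) :
    reflect (x = y \/ val x <= val y /\ clock (val x) < clock (val y)) (le' x y).
  apply: (iffP orP) => [[/eqP|/andP]|[/eqP|/andP]]; by [left|right].
have rootT : clock root <= phi (l root).
  by have /andP[/ltW] := phi_bounds (l root).
have [||||[x xT] xmax] := @Zorn T le'.
- by move=> t; rewrite /le' eqxx.
- move=> t y z /le'P[->//|[xy sxy]] /le'P[<-|[yz syz]]; apply/le'P; right => //.
  by split; [exact: le_trans yz|exact: lt_trans syz].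
- move=> t y /le'P[->//|[xy sxy]] /le'P[-> //|[yx syx]].
  by have := lt_trans sxy syx; rewrite ltxx.
- move=> A totA; have [A0|A0] := pselect (A !=set0); last first.
    exists (exist _ root rootT) => s As; exfalso; by apply: A0; exists s.
  have [//|nmax] := pselect (exists t, forall s, A s -> le' s t).
  have incA (x : T) : A x ->
      exists2 y, A y & val x <= val y /\ clock (val x) < clock (val y).
    move=> Ax; apply: contrapT => nx; apply: nmax; exists x => y Ay.
    have [xy|//] := totA _ _ Ax Ay.
    by case/le'P: xy => [->|xy]; [rewrite /le' eqxx|exfalso; apply: nx; exists y].
  have [|_ _ [x Ax <-] [y Ay <-]|_ [x Ax <-]|_ [x Ax <-]|z [Az sz]] :=
      @chain_limit (val @` A) 2.
  + by have [x Ax] := A0; exists (val x), x.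
  + by have [/le'P[->|[]]|/le'P[->|[]]] := totA _ _ Ax Ay; [left|left|left|right].
  + by have [y Ay] := incA _ Ax; exists (val y) => //; exists y.
  + by apply: le_trans (valP x) _; have /andP[_ /ltW] := phi_bounds (l (val x)).
  have zT : clock z <= phi (l z).
    (* The limit lies above the chain, so [phi (l z)] bounds every clock of the chain and hence
       their supremum. *)
    rewrite sz; apply: ge_sup.
      by have [x Ax] := A0; exists (clock (val x)), (val x) => //; exists x.
    move=> _ [_ [x Ax <-] <-]; apply: le_trans (valP x) _; apply: l_le; apply: Az.
    by exists x.
  exists (exist _ z zT) => x Ax; apply/le'P; right; split; first by apply: Az; exists x.
  have [y Ay [_ sxy]] := incA _ Ax; apply: lt_le_trans sxy _.
  by apply: le_clock; apply: Az; exists y.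
pose k := (x (clock x)).1.
have kx : pos x = 0 \/ k = (x (clock x)).1 by right.
(* A maximal [x] is extended as follows. Climbing to [x1] creates a positive gap
   [phi (l x1) - clock x]; a higher point [x2] of the ray whose colour is this gap is chosen for
   leaving. The new clock is [phi (l x1)], which is still at most [phi (l y)]. *)
have lt1 : pos x < pos x + 1 by rewrite ltrDl.
have [xx1 _ _] := dir_grow lt1 kx.
have [s1 p1 a1 e1] := growE lt1 kx.
set x1 := ext x (clock x) k (pos x + 1) in xx1 s1 p1 a1 e1.
have c_gt0 : 0 < phi (l x1) - clock x.
  by rewrite subr_gt0; apply: (le_lt_trans xT); apply: phi_lt; exact: l_lt.
have lt12 : pos x + 1 < pos x + 2 by rewrite ltrD2l ltr1n.
have [t /andP[t1 _] ct] := col_dense (clock x) k lt12 c_gt0.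
have lt2 := lt_trans lt1 t1.
have [xx2 _ _] := dir_grow lt2 kx.
have [s2 p2 a2 e2] := growE lt2 kx.
set x2 := ext x (clock x) k t in xx2 s2 p2 a2 e2.
have x12 : x1 < x2.
  rewrite lt_neqAle; apply/andP; split.
    by apply/eqP => x12; move: t1; rewrite -p1 -p2 x12 ltxx.
  apply/lepP; split; rewrite s1 ?p1 ?e1 ?e2 //=; [|exact: ltW|by right].
  by move=> v vx; rewrite a1 // a2.
have px2 : 0 < pos x2 by rewrite p2 (le_lt_trans (pos_ge0 x)).
have [x2y _ _] := dir_branch px2 ltr01 k1_neq0.
have sy : clock (ext x2 (nxt x2 (clock x2)) k1 1) = phi (l x1).
  rewrite clock_ext //; [|by right|by move=> /eqP; rewrite oner_eq0|by right].
  by rewrite /nxt s2 e2 /= ct addrC subrK.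
set y := ext x2 _ _ _ in x2y sy.
have x1y := lt_trans x12 x2y.
have yT : clock y <= phi (l y) by rewrite sy l_le // ltW.
have sxy : clock x < clock y by rewrite sy -subr_gt0.
have xy := lt_trans xx1 x1y.
have le'y : le' (exist _ x xT) (exist _ y yT).
  by apply/le'P; right; split => //; exact: ltW.
have yx : y = x := congr1 val (xmax _ le'y).
by move: sxy; rewrite yx ltxx.
Qed.

(** * Rigidity *)

Lemma cut_le_iff x w u u' : 0 <= (x w).2 -> 0 < u -> 0 < u' ->
  (cut x w u <= cut x w u') = (u <= u').
Proof.
move=> xw u_gt0 u'_gt0; have u0 := ltW u_gt0; have u'0 := ltW u'_gt0.
have ul : u = 0 -> limit_time x w by move=> uE; rewrite uE ltxx in u_gt0.
have u'l : u' = 0 -> limit_time x w by move=> uE; rewrite uE ltxx in u'_gt0.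
apply/idP/idP => [/le_pos|uu']; last exact: cut_mono.
by rewrite pos_cut // clock_cut // cut_at.
Qed.

(** The heights are included so that a failure on one and the same ray yields a map of heights that
    is not the identity. *)
Definition same_dir y z y' z' : Prop :=
  [/\ dir_time y z = dir_time y' z', dir_index y z = dir_index y' z' &
      dir_height y z = dir_height y' z'].

Section Automorphism.
Variables f g : point -> point.
Hypotheses (fK : cancel f g) (gK : cancel g f).
Hypotheses (f_homo : {homo f : x y / x <= y}) (g_homo : {homo g : x y / x <= y}).

Let f_le x y : (f x <= f y) = (x <= y).
Proof. by apply/idP/idP => [/g_homo|/f_homo //]; rewrite !fK. Qed.

Let f_lt x y : (f x < f y) = (x < y).
Proof. by rewrite !lt_neqAle f_le (can_eq fK). Qed.

Section Aligned.
Variables y z : point.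
Hypothesis yz : y < z.

Let w := dir_time y z.
Let w' := dir_time (f y) (f z).
Let a := dir_height y z.
Let a' := dir_height (f y) (f z).

(** Just above [y] and just above [f y] the branches follow one ray each, so [f] acts there as an
    increasing bijection [h] between two intervals of heights. *)
Lemma exists_aligned : exists e e' h,
  [/\ a < e <= (z w).2, a' < e' <= (f z w').2,
     forall u, a < u <= e -> a' < h u <= e' /\ f (cut z w u) = cut (f z) w' (h u),
     forall u v, a < u <= e -> a < v <= e -> (h u <= h v) = (u <= v) &
     forall u', a' < u' <= e' -> exists2 u, a < u <= e & h u = u'].
Proof.
have fyz : f y < f z by rewrite f_lt.
have [zw a0 az _] := dir_on yz; have [fzw a'0 a'z _] := dir_on fyz.
rewrite -/w -/a in zw a0 az; rewrite -/w' -/a' in fzw a'0 a'z.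
have [e [e' [ae ae' fe]]] : exists e e', [/\ a < e <= (z w).2,
    a' < e' <= (f z w').2 & f (cut z w e) = cut (f z) w' e'].
  have [yc cz] := dir_cut yz az (lexx _); have [yc' cz'] := dir_cut fyz a'z (lexx _).
  rewrite -/w -/w' in yc cz yc' cz'.
  (* Both tops lie below [f z]; the lower one is taken as the common end. *)
  have [fc|cf] : f (cut z w (z w).2) <= cut (f z) w' (f z w').2 \/
      cut (f z) w' (f z w').2 <= f (cut z w (z w).2).
  - by apply: le_total_below cz'; rewrite f_le.
  - have [|e' e'b fE] := dir_below fyz a'z (lexx _) _ fc; first by rewrite f_lt.
    by exists (z w).2, e'; split; rewrite ?az ?lexx.
  - have [||e eb gE] := dir_below yz az (lexx _) (x := g (cut (f z) w' (f z w').2)).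
    + by rewrite -f_lt gK.
    + by rewrite -f_le gK.
    by exists e, (f z w').2; split; rewrite ?a'z ?lexx // -gE gK.
have /andP[ae1 ez] := ae; have /andP[ae'1 e'z] := ae'.
have [h hP] : exists h : R -> R, forall u, a < u <= e ->
    a' < h u <= e' /\ f (cut z w u) = cut (f z) w' (h u).
  suff /choice[h hP] : forall u, exists u', a < u <= e ->
      a' < u' <= e' /\ f (cut z w u) = cut (f z) w' u' by exists h.
  move=> u; have [/andP[au ue]|nu] := boolP (a < u <= e); last by exists 0.
  have [yc _] := dir_cut yz au (le_trans ue ez).
  have [||u' u'b fE] := dir_below fyz ae'1 e'z (x := f (cut z w u)).
  - by rewrite f_lt.
  - rewrite -/w' -fe f_le cut_le_iff //; [exact: le_lt_trans au|exact: le_lt_trans ae1].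
  by exists u'.
have h_le u v : a < u <= e -> a < v <= e -> (h u <= h v) = (u <= v).
  move=> ue ve; have [/andP[hu _] fu] := hP u ue; have [/andP[hv _] fv] := hP v ve.
  case/andP: ue => au _; case/andP: ve => av _.
  rewrite -(cut_le_iff zw (le_lt_trans a0 au) (le_lt_trans a0 av)) -f_le fu fv.
  by rewrite cut_le_iff // (le_lt_trans a'0).
exists e, e', h; split=> // u' /andP[au' ue'].
have u'z := le_trans ue' e'z.
have u'_gt0 := le_lt_trans a'0 au'.
have [yc _] := dir_cut fyz au' u'z; rewrite -/w' in yc.
have [||u ub gE] := dir_below yz ae1 ez (x := g (cut (f z) w' u')).
- by rewrite -f_lt gK.
- by rewrite -/w -f_le gK fe cut_le_iff // (le_lt_trans a'0).
exists u => //; have [/andP[hu _] fu] := hP u ub.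
have : cut (f z) w' (h u) = cut (f z) w' u' by rewrite -fu -gE gK.
move=> cE; apply: le_anti; rewrite -!(cut_le_iff fzw) ?(le_lt_trans a'0) //.
by rewrite cE lexx.
Qed.

End Aligned.

(* Genericity of the colouring: if [f] changes the ray that leads from [y] to
   [z], then the time at which both that ray and its image are left can be
   prescribed, on a pair of rays that [f] still changes. *)
Lemma dir_step y z al be : y < z -> ~ same_dir y z (f y) (f z) -> 0 < al -> 0 < be ->
  dir_time y z + al <> dir_time (f y) (f z) + be ->
  exists y1 z1, [/\ y1 < z1, y < y1,
    clock y1 = dir_time y z /\ clock (f y1) = dir_time (f y) (f z),
    dir_time y1 z1 = dir_time y z + al &
    dir_time (f y1) (f z1) = dir_time (f y) (f z) + be].
Proof.
move=> yz ndir al0 be0 nab; have fyz : f y < f z by rewrite f_lt.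
have [e [e' [h [/andP[ae ez] /andP[ae' e'z] hP h_le h_surj]]]] := exists_aligned yz.
have [zw a0 _ _] := dir_on yz; have [fzw a'0 _ _] := dir_on fyz.
set w := dir_time y z in ez hP zw nab *.
set a := dir_height y z in ae hP h_le h_surj a0 *.
set w' := dir_time (f y) (f z) in e'z hP fzw nab *.
set a' := dir_height (f y) (f z) in ae' hP h_surj a'0 *.
have h_lt u v : a < u <= e -> a < v <= e -> (h u < h v) = (u < v).
  by move=> ue ve; rewrite !ltNge h_le.
have [|u v y' au uv ve|||//|t /andP[at_ te] [ct ct']] :=
  @col_generic w (z w).1 w' (f z w').1 a e h al be ae.
- move=> u v au uv ve; rewrite h_lt //.
    by rewrite au ltW // (lt_trans uv).
  by rewrite (lt_trans au uv) ltW.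
- have ue : a < u <= e by rewrite au ltW // (lt_trans uv).
  have ve' : a < v <= e by rewrite (lt_trans au uv) ltW.
  move=> /andP[uy yv]; have [/andP[hu _] _] := hP u ue; have [/andP[_ hv] _] := hP v ve'.
  have [|c ce cE] := h_surj y'; first by rewrite (lt_trans hu uy) (le_trans (ltW yv)).
  by exists c => //; rewrite -(h_lt u c) // -(h_lt c v) // cE uy yv.
(* If the two rays coincide, then [h] is not the identity: otherwise its image would force [a = a'],
   and the direction would be preserved. *)
- have [|wk] := pselect ((w, (z w).1) <> (w', (f z w').1)); first by left.
  right; apply: contrapT => hid; apply: ndir.
  move/contrapT: wk => wk; have {}hid u : a < u < e -> h u = u.
    by move=> ue; apply: contrapT => hu; apply: hid; exists u.
  have hE u : a < u -> u < e -> a' < u.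
    move=> au ue; have [|/andP[+ _] _] := hP u; first by rewrite au ltW.
    by rewrite hid // au ue.
  split; [by case: wk|by case: wk|rewrite -/a -/a'].
  apply/eqP; rewrite eq_le; apply/andP; split; rewrite leNgt; apply/negP => aa.
    pose u' := Num.min a e'; have [|u /andP[au ue] hu] := h_surj ((a' + u') / 2).
      have : a' < u' by rewrite lt_min aa ae'.
      have : u' <= e' by rewrite ge_min lexx orbT.
      by move=> h1 h2; apply/andP; split; lra.
    have u'a : u' <= a by rewrite ge_min lexx.
    have a'u' : a' < u' by rewrite lt_min aa ae'.
    move: ue; rewrite le_eqVlt => /orP[/eqP ue|ue]; last first.
      have := hid u; rewrite au ue hu => /(_ isT); lra.
    have : h ((a + e) / 2) < h u.
      by rewrite h_lt ?ue; [lra|apply/andP; split; lra|rewrite ae lexx].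
    rewrite hid ?hu; last by apply/andP; split; lra.
    lra.
  have := hE ((a + Num.min a' e) / 2).
  have m1 : a < Num.min a' e by rewrite lt_min aa ae.
  have m2 : Num.min a' e <= a' by rewrite ge_min lexx.
  have m3 : Num.min a' e <= e by rewrite ge_min lexx orbT.
  by move=> H; have := H ltac:(lra) ltac:(lra); lra.
- by [].
have t_gt0 := le_lt_trans a0 at_; have t0 := ltW t_gt0.
have tl : t = 0 -> limit_time z w by move=> tE; rewrite tE ltxx in t_gt0.
have te' : a < t <= e by rewrite at_ ltW.
have [/andP[aht hte'] fy1] := hP t te'.
have ht_gt0 := le_lt_trans a'0 aht; have ht0 := ltW ht_gt0.
have htl : h t = 0 -> limit_time (f z) w' by move=> tE; rewrite tE ltxx in ht_gt0.
set y1 := cut z w t in fy1.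
have [yy1 y1z] := dir_cut yz at_ (le_trans (ltW te) ez); rewrite -/w -/y1 in yy1 y1z.
have sy1 : clock y1 = w by rewrite clock_cut.
have py1 : pos y1 = t by rewrite pos_cut.
have ey1 : y1 w = ((z w).1, t) by rewrite cut_at // gt_eqF.
have sfy1 : clock (f y1) = w' by rewrite fy1 clock_cut.
have pfy1 : pos (f y1) = h t by rewrite fy1 pos_cut.
have efy1 : f y1 w' = ((f z w').1, h t) by rewrite fy1 cut_at // gt_eqF.
have py1_gt0 : 0 < pos y1 by rewrite py1.
have [y1z1 tz1 _] := dir_branch py1_gt0 ltr01 k1_neq0.
set z1 := ext y1 _ _ _ in y1z1 tz1.
have tE : dir_time y1 z1 = w + al by rewrite tz1 /nxt sy1 ey1 /= ct.
exists y1, z1; split=> //.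
have fy1z1 : f y1 < f z1 by rewrite f_lt.
rewrite /dir_time; case: ifP => [st|_]; last by rewrite /nxt sfy1 efy1 /= ct'.
(* If [f z1] stayed on the ray of [f y1], it would share a component above [f y1] with the image of
   [cut z w e]. By the inverse, [z1] and [cut z w e] would share one above [y1], although only [z1]
   leaves the ray there. *)
exfalso.
have e_gt0 := lt_trans t_gt0 te; have e0 := ltW e_gt0.
have el : e = 0 -> limit_time z w by move=> eE; rewrite eE ltxx in e_gt0.
have y1e : y1 < cut z w e.
  rewrite lt_neqAle cut_le_iff // (ltW te) andbT; apply/eqP => /(congr1 pos).
  by rewrite py1 pos_cut // => tE'; rewrite tE' ltxx in te.
have tle : dir_time y1 (cut z w e) = w.
  by rewrite /dir_time /straight py1 sy1 cut_at //= te.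
have fy1e : f y1 < f (cut z w e) by rewrite f_lt.
have eint : a < e <= e by rewrite ae lexx.
have [/andP[ahe _] fe] := hP e eint.
have he_gt0 := le_lt_trans a'0 ahe; have he0 := ltW he_gt0.
have hel : h e = 0 -> limit_time (f z) w' by move=> eE; rewrite eE ltxx in he_gt0.
have ste : straight (f y1) (f (cut z w e)).
  by rewrite /straight pfy1 sfy1 fe cut_at //= h_lt.
have [||m y1m [mz1 me]] := dir_common fy1z1 fy1e.
- by rewrite /dir_time st ste.
- rewrite /dir_index /dir_time st ste -(le_index (ltW fy1z1)) ?pfy1 //.
  by rewrite -(le_index (ltW fy1e)) ?pfy1.
have y1gm : y1 < g m by rewrite -f_lt gK.
have [|t1 _] := dir_mono y1gm (z := z1); first by rewrite -f_le gK.
have [|t2 _] := dir_mono y1gm (z := cut z w e); first by rewrite -f_le gK.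
by move: tle; rewrite -t2 t1 tE => /eqP; rewrite -subr_eq0 addrAC subrr add0r gt_eqF.
Qed.

(** Iterating [dir_step] from a changed direction gives a chain whose clock stays below [M] while
    that of its image exceeds every integer. The chain has an upper bound, whose image would have
    infinite clock. *)
Lemma dir_preserved y z : y < z -> same_dir y z (f y) (f z).
Proof.
move=> yz; apply: contrapT => ndir.
pose M := dir_time y z + 1.
pose W (p : point * point) := dir_time p.1 p.2.
pose W' (p : point * point) := dir_time (f p.1) (f p.2).
pose good p := [/\ p.1 < p.2, ~ same_dir p.1 p.2 (f p.1) (f p.2) & W p < M].
have [F FP] : exists F : point * point -> point * point, forall p, good p ->
    [/\ good (F p), p.1 < (F p).1, clock (F p).1 = W p /\ clock (f (F p).1) = W' p,
        W p < W (F p) & W' p + 1 <= W' (F p)].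
  suff /choice[F FP] : forall p : point * point, exists q, good p ->
    [/\ good q, p.1 < q.1, clock q.1 = W p /\ clock (f q.1) = W' p,
        W p < W q & W' p + 1 <= W' q] by exists F.
  move=> p; have [[pp np Wp]|ngood] := pselect (good p); last by exists p.
  (* Spending half of the remaining time keeps the clock below [M]. *)
  pose al := (M - W p) / 2; have al0 : 0 < al by rewrite /al; lra.
  (* The value [2] replaces [1] if the two times would coincide; distinct times ensure that the next
     direction is changed too. *)
  pose be : R := if W p + al == W' p + 1 then 2 else 1.
  have be1 : 1 <= be by rewrite /be; case: ifP => // _; lra.
  have nab : W p + al <> W' p + be.
    by rewrite /be; case: eqP => // -> /addrI/eqP; rewrite lt_eqF // ltr1n.
  have be0 : 0 < be by exact: lt_le_trans be1.
  have [y1 [z1 [yz1 py1 sy1 tE tE']]] := dir_step pp np al0 be0 nab.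
  exists (y1, z1) => _; rewrite /good /W /W' /= tE tE'; split=> //.
  - split=> //; last first.
      by rewrite -/(W p) -ltrBrDl /al gtr_pMr ?subr_gt0 // invf_lt1 // ltr1n.
    by move=> [t12 _ _]; apply: nab; rewrite -tE -tE'.
  - by rewrite ltrDl.
  - by rewrite lerD2l.
pose p n := iter n F (y, z).
have good_p n : good (p n).
  elim: n => [|n IH]; last by have [] := FP _ IH.
  by split; rewrite // /W /M /= ltrDl.
have step n := FP _ (good_p n).
pose x n := (p n.+1).1.
have x_lt n : x n <= x n.+1 by have [_ /ltW] := step n.+1.
have x_le m n : (m <= n)%N -> x m <= x n.
  by move=> /subnK <-; elim: (n - m)%N => // i IH; apply: le_trans IH _.
have clock_x n : clock (x n) = W (p n) by have [_ _ []] := step n.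
have clock_fx n : clock (f (x n)) = W' (p n) by have [_ _ []] := step n.
have W'_ge n : n%:R <= W' (p n).
  elim: n => [|n IH]; first exact: le_trans (clock_ge0 (f y)) (dir_time_ge _ _).
  by have [_ _ _ _] := step n; apply: le_trans; rewrite -natr1 lerD2r.
have [|_ _ [m _ <-] [n _ <-]|_ [n _ <-]|_ [n _ <-]|lim [xlim _]] :=
  @chain_limit (range x) M.
- by exists (x 0), 0.
- by have [/x_le|/ltnW/x_le] := leqP m n; [left|right].
- exists (x n.+1); first by exists n.+1.
  by split=> //; rewrite !clock_x; have [] := step n.
- by rewrite clock_x; have [_ _ /ltW] := good_p n.
pose n := Num.bound (clock (f lim)).
have : n%:R <= clock (f lim).
  apply: le_trans (W'_ge n) _; rewrite -clock_fx; apply: le_clock.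
  by rewrite f_le; apply: xlim; exists n.
by rewrite leNgt archi_boundP // clock_ge0.
Qed.

End Automorphism.

Lemma exists_straight y : exists z, [/\ y < z, straight y z, dir_time y z = clock y &
  dir_height y z = pos y].
Proof.
have [||yz tE _] := @dir_grow y (y (clock y)).1 (pos y + 1).
- by rewrite ltrDl.
- by right.
exists (ext y (clock y) (y (clock y)).1 (pos y + 1)).
set z := ext _ _ _ _ in yz tE *.
have st : straight y z.
  apply: contraT => nst; move: tE; rewrite /dir_time (negbTE nst) => /eqP.
  by rewrite gt_eqF ?nxt_gt.
by split=> //; rewrite /dir_height st.
Qed.

Lemma aut_clock_pos f g : cancel f g -> cancel g f ->
  {homo f : x y / x <= y} -> {homo g : x y / x <= y} ->
  forall y, clock (f y) = clock y /\ pos (f y) = pos y.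
Proof.
move=> fK gK f_homo g_homo y.
have f_lt x z : x < z -> f x < f z.
  by move=> xz; rewrite lt_neqAle f_homo ?ltW // andbT (can_eq fK) lt_eqF.
have g_lt x z : x < z -> g x < g z.
  by move=> xz; rewrite lt_neqAle g_homo ?ltW // andbT (can_eq gK) lt_eqF.
have [z [yz _ tE hE]] := exists_straight y.
have [t1 _ h1] := dir_preserved fK gK f_homo g_homo yz.
case: (boolP (straight (f y) (f z))) => st.
  by move: t1 h1; rewrite tE hE /dir_time /dir_height st.
have [_ pfy _] := not_straight (f_lt _ _ yz) st.
(* Here [pos y] is [0] and [pos (f y)] is positive; a straight direction at [f y], preserved by the
   inverse, gives [pos (f y) = 0]. *)
have [z' [yz' _ _ hE']] := exists_straight (f y).
have [_ _] := dir_preserved gK fK g_homo f_homo yz'; rewrite hE' fK.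
move: h1; rewrite hE /dir_height (negbTE st) => py0.
by rewrite py0; case: ifP => _ pE; rewrite pE ltxx in pfy.
Qed.

(** Clock and height are preserved, so a point comparable with its image is fixed. If [x] is moved,
    the meet [m] of [x] and [f x] is fixed, and the preserved direction from [m] puts [x] and [f x]
    in one component above [m], against maximality. *)
Lemma rigid_point : rigid point.
Proof.
move=> f g fK gK f_homo g_homo x.
have cp := aut_clock_pos fK gK f_homo g_homo.
have eqI y : y <= f y \/ f y <= y -> f y = y.
  have [sE pE] := cp y; case=> [yf|fy]; [apply/esym|]; exact: eq_point.
apply: contrapT => nfx; have [m [[mx mfx] mmax]] := meet_exists x (f x).
have m_lt_x : m < x.
  rewrite lt_neqAle mx andbT; apply/eqP => mE.
  by apply: nfx; apply: eqI; left; rewrite -[leLHS]mE.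
have m_lt_fx : m < f x.
  rewrite lt_neqAle mfx andbT; apply/eqP => mE.
  by apply: nfx; apply: eqI; right; rewrite -mE.
have fm : f m = m.
  by apply: eqI; apply: le_total_below mfx _; exact: f_homo.
have [tE kE _] := dir_preserved fK gK f_homo g_homo m_lt_x.
rewrite fm in tE kE; have [m' mm' [m'x m'fx]] := dir_common m_lt_x m_lt_fx tE kE.
by have := mmax m' (conj m'x m'fx); rewrite (lt_geF mm').
Qed.

End Tree.

(** * Cantor's theorem and the conclusion *)

Lemma card_lt_set (T : pointedType) : card_lt T (set T).
Proof.
split.
  apply/pcard_injP; exists (fun x => [set x]) => x y _ _ xy.
  by have : [set y] x by rewrite -xy.
move=> /pcard_injP[f f_inj].
pose D := [set x | exists2 A, f A = x & ~ A x].
have [Df|nDf] := pselect (D (f D)).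
  have [A fA nA] := Df; have AD : A = D by apply: f_inj; rewrite ?in_setT.
  by apply: nA; rewrite AD.
by have [] := nDf; exists D.
Qed.

Lemma card_ge2 (K : Type) : `I_2 #<= [set: K] -> exists k0 k1 : K, k1 <> k0.
Proof.
move=> /card_leP[f].
have i0 : 0%N \in `I_2 by rewrite inE.
have i1 : 1%N \in `I_2 by rewrite inE.
exists (val (f (SigSub i0))), (val (f (SigSub i1))) => /val_inj.
by move=> /(@inj _ _ _ f); rewrite !in_setT => /(_ isT isT) /(congr1 val).
Qed.

Theorem theorem29 (R : realType) (C K : Type)
    (hC : is_succ_card (nat -> bool) C)
    (hK2 : `I_2 #<= [set: K]) (hKC : [set: K] #<= [set: C]) :
  exists (d : Order.disp_t) (X : porderType d),
    [/\ branchwise_real_tree X R,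
        uniformly_branching X K,
        rigid X &
        ~ continuously_gradable X R].
Proof.
have [k0 [k1 k10]] := card_ge2 hK2.
(* The power set of the continuum is larger than the continuum, so its cardinality is at least that
   of the successor [C]. *)
have /pcard_injP[j j_inj] : [set: K] #<= [set: set (nat -> bool)].
  exact: card_le_trans hKC (hC.2 _ (card_lt_set _)).
have {}j_inj : injective j by move=> x y; apply: j_inj; rewrite in_setT.
have [col [col_gt0 col_gen]] := exists_colouring R j_inj.
exists ring_display, (point k0 col); split.
- exact: branchwise_real_point.
- exact: uniformly_branching_point.
- exact: (rigid_point col_gt0 col_gen k10).
- exact: (not_gradable col_gt0 col_gen k10).
Qed.
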